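(* Let $k$ be a field, let $c\in k$, and let $\eta_c\in k[X]$ be a polynomial whose constant coefficient is $c$. Let $R:=k[X,Y,Z,T]/(X^2Y+Z^2+T^3+\eta_c(X))$, and let $x,z,t\in R$ denote the images of $X,Z,T$ respectively. Let $\phi\in\operatorname{Exp}(R/k)$ be an exponential map of $R$ over $k$, with ring of invariants $R^{\phi}$. If $R^{\phi}\neq R$, then $k[x]\subseteq R^{\phi}\subseteq k[x,z,t]$.
   Context: $k$ is an arbitrary field (any characteristic), and $X,Y,Z,T$ are indeterminates over $k$. For a $k$-algebra $R$ that is an integral domain, an exponential map of $R$ over $k$ is a $k$-algebra homomorphism $\phi\colon R\to R[U]$ ($U$ an indeterminate) such that (i) composing $\phi$ with the evaluation $U\mapsto 0$ gives the identity of $R$, and (ii) writing $\phi(a)=\sum_{n\ge 0}D_n(a)U^n$ (a finite sum for each $a\in R$), the family $\{D_n\}$ is iterative: $D_i\circ D_j=\binom{i+j}{i}D_{i+j}$ for all $i,j\ge 0$. Equivalently, $\phi$ is the co-action of an action of the additive group $\mathbb{G}_a$ over $k$ on $\operatorname{Spec}R$. $\operatorname{Exp}(R/k)$ denotes the set of all such maps, and $R^{\phi}:=\{a\in R : \phi(a)=a\}$ is the ring of $\phi$-invariants. $k[x]$ and $k[x,z,t]$ denote the $k$-subalgebras of $R$ generated by the indicated elements. *)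

(* Defs.v *)
From HB Require Import structures.
From mathcomp Require Import all_boot all_order all_algebra ring_quotient.
From mathcomp Require Import boolp classical_sets.
From mathcomp Require Import mpoly.

Set Implicit Arguments.
Unset Strict Implicit.
Unset Printing Implicit Defensive.

Import GRing.Theory.

Local Open Scope classical_set_scope.
Local Open Scope ring_scope.
Local Open Scope quotient_scope.

(* The indeterminate U is the variable 'X of {poly R}, and D_n r is the
   coefficient (phi r)`_n.  As {poly R} is an algebra over R but carries no
   canonical k-algebra structure, k-linearity is the compatibility of the ring
   morphism phi with the structure maps k -> R and k -> R -> R[U].  The
   defining conditions are stated for any commutative k-algebra. *)
Record exponential_map (k : fieldType) (R : comAlgType k)
    (phi : {rmorphism R -> {poly R}}) : Prop := ExponentialMap {
  exponential_map_alg : forall a : k, phi a%:A = (a%:A)%:P;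
  exponential_map_eval0 : forall r : R, (phi r).[0] = r;
  exponential_map_iterative : forall (i j : nat) (r : R),
    (phi (phi r)`_j)`_i = (phi r)`_(i + j) *+ 'C(i + j, i) }.

Definition Exp (k : fieldType) (R : comAlgType k) :
    set {rmorphism R -> {poly R}} :=
  [set phi | exponential_map phi].

Definition invariants (R : comNzRingType) (phi : R -> {poly R}) : set R :=
  [set a | phi a = a%:P].

Definition generated_subalg (k : fieldType) (R : comAlgType k) (S : set R) :
    set R :=
  smallest (fun A : set R => GRing.subalg_closed (mem A)) S.

(* The indeterminates X, Y, Z, T are 'X_0, 'X_1, 'X_2, 'X_3. *)
Definition defining_poly (k : fieldType) (eta : {poly k}) : {mpoly k[4]} :=
  'X_0 ^+ 2 * 'X_1 + 'X_2 ^+ 2 + 'X_3 ^+ 3 + (map_poly (@mpolyC 4 k) eta).['X_0].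

Definition defining_ideal (k : fieldType) (eta : {poly k}) :
    {pred {mpoly k[4]}} :=
  fun p => `[< exists q, p = q * defining_poly eta >].

Section Quotient.
Variables (k : fieldType) (eta : {poly k}).

Lemma defining_ideal_closed : idealr_closed (defining_ideal eta).
Proof.
split.
- by apply/asboolP; exists 0; rewrite mul0r.
- apply/asboolP => -[q].
  pose e := (map_poly (@mpolyC 4 k) eta).['X_0].
  pose v (i : 'I_4) : k := if i == 0 then 1 else
    if i == 1 then - e.@[fun j => (j == 0)%:R] else 0.
  move=> /(congr1 (meval v)); rewrite meval1 mevalM.
  suff -> : (defining_poly eta).@[v] = 0 by rewrite mulr0 => /eqP; rewrite oner_eq0.
  rewrite /defining_poly !mevalD !mevalM !mevalXU /v /= !(mulr0, mul0r, mulr1, mul1r, addr0).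
  have -> : meval v e = e.@[fun j => (j == 0)%:R].
    rewrite /e !horner_coef !raddf_sum; apply: eq_bigr => i _ /=.
    by rewrite coef_map /= !mevalM !mevalC !rmorphXn /= !mevalXU.
  by rewrite addNr.
- move=> a p r /asboolP[q ->] /asboolP[s ->]; apply/asboolP.
  by exists (a * q + s); rewrite mulrDl mulrA.
Qed.

HB.instance Definition _ :=
  isIdealr.Build {mpoly k[4]} (defining_ideal eta) defining_ideal_closed.

Definition coord_ring : Type := {ideal_quot (defining_ideal eta)}.

HB.instance Definition _ := GRing.ComNzRing.on coord_ring.

Definition coord_class (p : {mpoly k[4]}) : coord_ring :=
  \pi_{ideal_quot (defining_ideal eta)} p.

Lemma coord_classD : {morph coord_class : p q / p + q}.
Proof. exact: rmorphD. Qed.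

Lemma coord_classM : {morph coord_class : p q / p * q}.
Proof. exact: rmorphM. Qed.

Lemma coord_class1 : coord_class 1 = 1.
Proof. exact: rmorph1. Qed.

Definition coord_scale (a : k) (r : coord_ring) : coord_ring :=
  coord_class a%:MP * r.

Lemma coord_scaleA a b r :
  coord_scale a (coord_scale b r) = coord_scale (a * b) r.
Proof. by rewrite /coord_scale mulrA -coord_classM -mpolyCM. Qed.

Lemma coord_scale1 : left_id 1 coord_scale.
Proof. by move=> r; rewrite /coord_scale coord_class1 mul1r. Qed.

Lemma coord_scaleDr : right_distributive coord_scale +%R.
Proof. by move=> a r s; rewrite /coord_scale mulrDr. Qed.

Lemma coord_scaleDl r : {morph coord_scale^~ r : a b / a + b}.
Proof. by move=> a b; rewrite /coord_scale mpolyCD coord_classD mulrDl. Qed.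

HB.instance Definition _ := GRing.Zmodule_isLmodule.Build k coord_ring
  coord_scaleA coord_scale1 coord_scaleDr coord_scaleDl.

Lemma coord_scaleAl (a : k) (r s : coord_ring) : a *: (r * s) = a *: r * s.
Proof. by rewrite /GRing.scale /= /coord_scale mulrA. Qed.

HB.instance Definition _ :=
  GRing.Lmodule_isLalgebra.Build k coord_ring coord_scaleAl.

HB.instance Definition _ := GRing.Lalgebra_isComAlgebra.Build k coord_ring.

Lemma coord_class_alg (a : k) : coord_class a%:MP = a%:A.
Proof. by rewrite /GRing.scale /= /coord_scale mulr1. Qed.

End Quotient.

(* Main.v *)
Require Import Defs.
From HB Require Import structures.
From mathcomp Require Import all_boot all_order all_algebra ring_quotient.
From mathcomp Require Import boolp classical_sets.
From mathcomp Require Import mpoly.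
From mathcomp Require Import zify ring.

Set Implicit Arguments.
Unset Strict Implicit.
Unset Printing Implicit Defensive.

Import Order.TTheory GRing.Theory Num.Theory.

Local Open Scope classical_set_scope.
Local Open Scope ring_scope.
Local Open Scope quotient_scope.

(* Fix the degree function of R in which x has degree -1 and z, t degree 0
   (so y has degree 2).  A suitable weight u of U makes phi : R -> R[U] a
   filtered map whose leading part is nontrivial; a second grading (z, t of
   weights 3, 2) is refined in the same way.  Iterativity shows that the
   leading U-coefficient of the leading part of phi(a) is again invariant.

   If an invariant involved y, then y would be invariant for the leading part,
   which would give Qx, Qz, Qt in k[z,t][U], not all constant and with values
   1, z, t at U = 0, such that p Qx^2 = Qz^2 + Qt^3, where p = z^2 + t^3.
   Comparing degrees in U, weights, and invariant weighted forms leaves equations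
   a P^2 = c + Q^3, which a derivation of the coefficients excludes in every
   characteristic.  Hence the invariants lie in k[x,z,t].

   If x were not invariant, restriction to x = 0 would embed the invariants into
   the elements of k[z,t] fixed by the leading part.  Filtering the monomials
   x^a z^b t^c (a, b, c <= N) by the U-degree of phi would bound their number
   (N+1)^3 by O(N^2), since each graded piece embeds into a space of such fixed
   elements, whose dimension is only linear in the degree. *)

(** * Leading coefficients with respect to a grading *)

(** A grading enters as a relation and not as a degree function because the weight of U is a
    rational number u / L, known only after phi: degrees are scaled by L, and d may stay a mere
    upper bound. The associated graded ring is never built. Leading components are read in k[z,t]
    with x set to 1, which forces y to be -(z^2 + t^3 + c); the degree that this forgets is carried
    by the index d. The two gradings have different purposes. In the first, x has negative degree,
    so eta(x) shrinks to its constant c. In the second, z^2 + t^3 has weight 6 and c has weight 0,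
    so c drops out and the cusp p is left. The obstacle is the characteristic: D_1 may vanish, so no
    derivation of R can replace phi. Iterativity acts through the invariance of top U-coefficients,
    and the derivations of the last step live on k[z,t], where d/dz yields 2 = 0 and d/dt yields 3 =
    0. *)

(* [T d a c]: a has degree at most d and its component of degree d is c (so
   c = 0 when the degree is smaller). *)
Record top_rel (G : zmodType) (pos : G -> Prop) (A C : comNzRingType)
    (T : G -> A -> C -> Prop) : Prop := TopRel {
  top0 : forall d, T d 0 0;
  top1 : T 0 1 1;
  topN : forall d a c, T d a c -> T d (- a) (- c);
  topD : forall d a b c c', T d a c -> T d b c' -> T d (a + b) (c + c');
  topM : forall d e a b c c', T d a c -> T e b c' -> T (d + e) (a * b) (c * c');
  top_uniq : forall d a c c', T d a c -> T d a c' -> c = c';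
  top_pos : forall d e a c, T d a c -> pos e -> T (d + e) a 0 }.

(* The indeterminate of {poly A} receives the weight u. *)
Definition poly_top (G : zmodType) (A C : comNzRingType) (T : G -> A -> C -> Prop)
    (u d : G) (P : {poly A}) (Q : {poly C}) : Prop :=
  forall n, T (d - u *+ n) P`_n Q`_n.

(** Taking leading parts twice is again a grading, with degrees in pairs compared lexicographically,
    so both stages can be handled as one. *)
Definition lex_top (G H : zmodType) (A B C : comNzRingType) (T : G -> A -> B -> Prop)
    (S : H -> B -> C -> Prop) (d : G * H) (a : A) (c : C) : Prop :=
  exists2 b, T d.1 a b & S d.2 b c.

Section TopRelTheory.
Variables (G : zmodType) (pos : G -> Prop) (A C : comNzRingType).
Variables (T : G -> A -> C -> Prop) (hT : top_rel pos T).

Lemma top_sum (I : Type) (r : seq I) (P : pred I) d (a : I -> A) (c : I -> C) :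
  (forall i, P i -> T d (a i) (c i)) ->
  T d (\sum_(i <- r | P i) a i) (\sum_(i <- r | P i) c i).
Proof.
move=> h; elim/big_ind2: _ => //; first exact: top0 hT d.
by move=> *; apply: (topD hT).
Qed.

Lemma topMn d a c n : T d a c -> T d (a *+ n) (c *+ n).
Proof.
move=> h; elim: n => [|n IHn]; first by rewrite !mulr0n; exact: top0 hT d.
by rewrite !mulrSr; apply: (topD hT).
Qed.

Lemma topX d a c n : T d a c -> T (d *+ n) (a ^+ n) (c ^+ n).
Proof.
move=> h; elim: n => [|n IHn]; first by rewrite mulr0n !expr0; exact: top1 hT.
by rewrite mulrSr !exprSr; apply: (topM hT).
Qed.

Lemma top0_eq0 d c : T d 0 c -> c = 0.
Proof. by move=> h; apply: (top_uniq hT h); exact: top0 hT d. Qed.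

Lemma top_lower d e a c : T d a c -> pos (e - d) -> T e a 0.
Proof. by move=> h /(top_pos hT h); rewrite addrC subrK. Qed.

Lemma top_poly u : top_rel pos (poly_top T u).
Proof.
split=> [d n|n|d P Q h n|d P P' Q Q' h h' n|d e P P' Q Q' h h' n|d P Q Q' h h'|d e P Q h pe n].
- by rewrite !coef0; exact: top0 hT _.
- rewrite !coef1; case: n => [|n] /=; last exact: top0 hT _.
  by rewrite mulr0n subr0; exact: top1 hT.
- by rewrite !coefN; apply: (topN hT).
- by rewrite !coefD; apply: (topD hT).
- rewrite !coefM; apply: top_sum => j _.
  have -> : d + e - u *+ n = (d - u *+ j) + (e - u *+ (n - j)).
    by rewrite addrACA -opprD -mulrnDr subnKC // -ltnS.
  exact: (topM hT).
- by apply/polyP => n; apply: (top_uniq hT) (h' n).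
- by rewrite coef0 addrAC; apply: (top_pos hT).
Qed.

(** Used along [phi], to make leading parts multiplicative, and along morphisms into a field of
    fractions, to define degrees as orders of poles. *)
Lemma top_comp (B : comNzRingType) (f : {rmorphism B -> A}) :
  top_rel pos (fun d b c => T d (f b) c).
Proof.
split.
- by move=> d; rewrite rmorph0; exact: top0 hT d.
- by rewrite rmorph1; exact: top1 hT.
- by move=> d a c h; rewrite rmorphN; apply: (topN hT).
- by move=> *; rewrite rmorphD; apply: (topD hT).
- by move=> *; rewrite rmorphM; apply: (topM hT).
- by move=> d a c c'; exact: (top_uniq hT).
- by move=> d e a c h pe; apply: (top_pos hT h).
Qed.
End TopRelTheory.

Definition int_pos : int -> Prop := fun d => 0 < d.

Definition lex_pos (d : int * int) : Prop := 0 < d.1 \/ d.1 = 0 /\ 0 < d.2.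

Lemma top_lex (A B C : comNzRingType) (T : int -> A -> B -> Prop)
    (S : int -> B -> C -> Prop) :
  top_rel int_pos T -> top_rel int_pos S ->
  top_rel lex_pos (lex_top T S).
Proof.
move=> hT hS; rewrite /lex_top; split=> [[d e]||d a c|d a a' c c'|d d' a a' c c'|d a c c'|d d' a c] /=.
- by exists 0; [exact: top0 hT d | exact: top0 hS e].
- by exists 1; [exact: top1 hT | exact: top1 hS].
- by case=> b h h'; exists (- b); [apply: (topN hT) | apply: (topN hS)].
- case=> b h h' [b' k k']; exists (b + b');
    [exact: (topD hT) | exact: (topD hS)].
- case=> b h h' [b' k k']; exists (b * b'); [exact: (topM hT) | exact: (topM hS)].
- case=> b h h' [b' k k']; rewrite (top_uniq hT k h) in k'.
  exact: (top_uniq hS) k'.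
- case=> b h h' [pd|[d0 pd]].
    by exists 0; [apply: (top_pos hT h) | exact: top0 hS _].
  by exists b; [rewrite d0 addr0 | apply: (top_pos hS h')].
Qed.

Section LaurentTop.
Variable D : idomainType.
Local Notation F := {fraction {poly D}}.

(* a = 'X^(-d) * q with q`_0 = c, i.e. the degree is the order of pole at 0. *)
Definition laurent_top (d : int) (a : F) (c : D) : Prop :=
  exists m n q, [/\ a * (tofrac 'X) ^+ m = tofrac ('X ^+ n * q),
    d = m%:Z - n%:Z & q`_0 = c].

Lemma laurent_topP : top_rel int_pos laurent_top.
Proof.
split.
- move=> d; case: d => n.
    exists n, 0%N, 0; split; rewrite ?coef0 //; last by rewrite subr0.
    by rewrite mulr0 tofrac0 mul0r.
  exists 0%N, n.+1, 0; split; rewrite ?coef0 //; last by rewrite NegzE sub0r.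
  by rewrite mulr0 tofrac0 mul0r.
- by exists 0%N, 0%N, 1; split; rewrite ?subr0 ?coef1 // !expr0 !mulr1 tofrac1.
- move=> d a c [m [n [q [h1 h2 h3]]]]; exists m, n, (- q).
  by split=> //; [rewrite mulrN tofracN mulNr h1 | rewrite coefN h3].
- move=> d a b c c' [m [n [q [h1 h2 h3]]]] [m' [n' [q' [h1' h2' h3']]]].
  exists (m + m')%N, (n + m')%N, (q + q'); split.
  + rewrite mulrDl exprD mulrA h1 mulrCA h1'.
    rewrite !tofracM !tofracXn tofracD exprD.
    have -> : tofrac 'X ^+ m * (tofrac 'X ^+ n' * tofrac q') =
      tofrac 'X ^+ (m + n') * tofrac q' :> F by rewrite mulrA exprD.
    have -> : (m + n' = n + m')%N by lia.
    rewrite exprD; ring.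
  + lia.
  + by rewrite coefD h3 h3'.
- move=> d e a b c c' [m [n [q [h1 h2 h3]]]] [m' [n' [q' [h1' h2' h3']]]].
  exists (m + m')%N, (n + n')%N, (q * q'); split.
  + by rewrite exprD (mulrACA a) h1 h1' -tofracM mulrACA -exprD.
  + lia.
  + by rewrite coef0M h3 h3'.
- move=> d a c c' [m [n [q [h1 h2 h3]]]] [m' [n' [q' [h1' h2' h3']]]].
  have : tofrac ('X ^+ (n + m') * q) = tofrac ('X ^+ (n' + m) * q') :> F.
    rewrite !exprD (mulrAC _ _ q) (mulrAC _ _ q') tofracM [RHS]tofracM -h1 -h1'.
    by rewrite !tofracXn mulrAC.
  move/eqP; rewrite tofrac_eq => /eqP.
  have -> : (n' + m = n + m')%N by lia.
  by move/(mulfI (expf_neq0 _ (negbT (polyX_eq0 _)))) => eq_q; rewrite -h3 -h3' eq_q.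
- move=> d e a c [m [n [q [h1 h2 h3]]]].
  rewrite /int_pos; case: e => // k k0.
  exists (m + k)%N, n, ('X ^+ k * q); split.
  + by rewrite exprD (mulrA a) h1 mulrCA [RHS]tofracM tofracXn mulrC.
  + lia.
  + by rewrite coefXnM; case: k k0.
Qed.

Lemma laurent_top_poly (q : {poly D}) : laurent_top 0 (tofrac q) q`_0.
Proof. by exists 0%N, 0%N, q; split; rewrite ?subr0 // !expr0 mulr1 mul1r. Qed.

Lemma laurent_topX n : laurent_top (- n%:Z) (tofrac 'X ^+ n) 1.
Proof.
exists 0%N, n, 1; split; rewrite ?sub0r ?coef1 //.
by rewrite expr0 !mulr1 tofracXn.
Qed.

Lemma laurent_topVX n : laurent_top n%:Z (tofrac 'X ^- n) 1.
Proof.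
exists n, 0%N, 1; split; rewrite ?subr0 ?coef1 //.
by rewrite expr0 !mulr1 tofrac1 mulVf // expf_neq0 // tofrac_eq0 polyX_eq0.
Qed.
End LaurentTop.

(* (L, u) encodes the rational number - u / L, the maximal slope of s. *)
Lemma max_slope (s : seq (nat * int)) : s != [::] ->
  all (fun p => 0 < p.1)%N s ->
  exists (L : nat) (u : int), [/\ (0 < L)%N,
    (forall p, p \in s -> L%:Z * p.2 + u *+ p.1 <= 0) &
    exists2 p, p \in s & L%:Z * p.2 + u *+ p.1 = 0].
Proof.
have mulE (u : int) (n : nat) : u *+ n = u * n%:Z by rewrite -mulr_natr natz.
have eq0 (n : nat) (e : int) : n%:Z * e + - e *+ n = 0.
  by rewrite mulE; ring.
elim: s => // [[n e] [|p s]] IHs _ /= /andP[n0 hs].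
  exists n, (- e); split=> // [p|].
    by rewrite mem_seq1 => /eqP-> /=; rewrite eq0.
  by exists (n, e); rewrite ?mem_seq1 ?eq0.
have [L [u [L0 hu [q qs eq_q]]]] := IHs isT hs.
have [le0|gt0] := lerP (L%:Z * e + u *+ n) 0.
  exists L, u; split=> //; last by exists q; rewrite // in_cons qs orbT.
  by move=> r; rewrite in_cons => /orP[/eqP-> //|]; exact: hu.
(* The new point has slope e / n, larger than the previous maximum - u / L. *)
exists n, (- e); split=> //; last first.
  by exists (n, e); rewrite ?eq0 // in_cons eqxx.
move=> r; rewrite in_cons => /orP[/eqP->/=|rs].
  by rewrite eq0.
have := hu _ rs; have /allP/(_ _ rs) : all (fun p => 0 < p.1)%N (p :: s) by [].
case: r {rs} => m f /=; rewrite mulE in gt0; rewrite !mulE => m0 hL.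
rewrite -(@pmulr_rle0 _ L%:Z); last by lia.
have -> : L%:Z * (n%:Z * f + - e * m%:Z) =
  n%:Z * (L%:Z * f + u * m%:Z) - m%:Z * (L%:Z * e + u * n%:Z) by ring.
have : n%:Z * (L%:Z * f + u * m%:Z) <= 0 by rewrite pmulr_rle0 //; lia.
have : 0 <= m%:Z * (L%:Z * e + u * n%:Z) by rewrite pmulr_rge0 ?ltW //; lia.
lia.
Qed.

Section CoefDerivation.
Variables (C : comNzRingType) (E : {additive C -> C}).
Hypothesis E_M : forall a b, E (a * b) = E a * b + a * E b.

Lemma map_polyM_der (P Q : {poly C}) :
  map_poly E (P * Q) = map_poly E P * Q + P * map_poly E Q.
Proof.
apply/polyP => n; rewrite coefD !coefM coef_map /= coefM raddf_sum -big_split /=.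
by apply: eq_bigr => i _; rewrite E_M !coef_map.
Qed.
End CoefDerivation.

Lemma size_map_additive (C : comNzRingType) (E : {additive C -> C}) (P : {poly C}) :
  (size (map_poly E P) <= size P)%N.
Proof. by rewrite map_polyE; apply: leq_trans (size_Poly _) _; rewrite size_map. Qed.

(* Multiply the derived equation by Q and eliminate b Q^3: the remaining
   identity equates a multiple of P with a polynomial of degree deg Q < deg P. *)
Lemma cusp_derivation (C : idomainType) (E : {additive C -> C})
    (E_M : forall a b, E (a * b) = E a * b + a * E b)
    (a c : C) (P Q : {poly C}) :
  a%:P * P ^+ 2 = c%:P + Q ^+ 3 -> (size Q < size P)%N ->
  Q`_0 * E c = 3%:R * c * E Q`_0.
Proof.
move=> eqPQ ltQP.
pose e := map_poly E.
have eM p q : e (p * q) = e p * q + p * e q by exact: map_polyM_der.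
have eC d : e d%:P = (E d)%:P by rewrite /e map_polyC.
have eD p q : e (p + q) = e p + e q by rewrite /e raddfD.
pose W := P * ((E a)%:P * P * Q + 2%:R * a%:P * e P * Q - 3%:R * a%:P * P * e Q).
have eqW : W = (E c)%:P * Q - 3%:R * c%:P * e Q.
  have /(congr1 e) := eqPQ.
  rewrite eM eD !eC !exprS !expr0 !mulr1 !eM => h.
  have {}h : ((E a)%:P * (P * P) + a%:P * (e P * P + P * e P)) * Q -
     ((E c)%:P + (e Q * (Q * Q) + Q * (e Q * Q + Q * e Q))) * Q = 0.
    by rewrite h subrr.
  have k : 3%:R * e Q * (a%:P * P ^+ 2 - (c%:P + Q ^+ 3)) = 0.
    by rewrite eqPQ subrr mulr0.
  apply/eqP; rewrite -subr_eq0; apply/eqP.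
  rewrite -(subr0 0) -{1}h -k /W; ring.
have W0 : W = 0.
  apply/eqP; apply: contraTT ltQP => nzW.
  rewrite -leqNgt; apply: (@leq_trans (size W)).
    by apply: dvdp_leq => //; rewrite /W dvdp_mulr.
  rewrite eqW; apply: leq_trans (size_polyD _ _) _.
  rewrite geq_max size_polyN mul_polyC size_scale_leq /=.
  rewrite -polyC_natr -polyCM mul_polyC; apply: leq_trans (size_scale_leq _ _) _.
  exact: size_map_additive.
move: eqW; rewrite W0 => /(congr1 (fun p : {poly C} => p`_0)).
rewrite coef0 coefB -polyC_natr -polyCM !coefCM coef_map => /eqP.
by rewrite eq_sym subr_eq0 mulrC => /eqP.
Qed.

(** * Evaluation morphisms and the universal property of the coordinate ring *)

Definition ev1 (A S : comNzRingType) (f : {rmorphism A -> S}) (s : S) :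
    {poly A} -> S := horner_morph (fun a => mulrC s (f a)).

HB.instance Definition _ A S f s := GRing.RMorphism.on (@ev1 A S f s).

Section Ev1.
Variables (A S : comNzRingType) (f : {rmorphism A -> S}) (s : S).

Lemma ev1C a : ev1 f s a%:P = f a.
Proof. exact: horner_morphC. Qed.

Lemma ev1X : ev1 f s 'X = s.
Proof. exact: horner_morphX. Qed.

Lemma ev1E n (p : {poly A}) : (size p <= n)%N ->
  ev1 f s p = \sum_(i < n) f p`_i * s ^+ i.
Proof.
move=> le_pn; rewrite -{1}(coefK p) poly_def rmorph_sum /=.
rewrite (big_ord_widen n (fun i => ev1 f s (p`_i *: 'X^i)) le_pn) big_mkcond /=.
apply: eq_bigr => i _; case: ltnP => [_|le_pi].
  by rewrite -mul_polyC rmorphM rmorphXn /= ev1C ev1X.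
by rewrite nth_default // rmorph0 mul0r.
Qed.

End Ev1.

Lemma rmorph_ev1 (A S B : comNzRingType) (f : {rmorphism A -> S}) (s : S)
    (g : {rmorphism S -> B}) (p : {poly A}) :
  g (ev1 f s p) = ev1 (g \o f) (g s) p.
Proof.
rewrite (ev1E _ _ (leqnn _)) [RHS](ev1E _ _ (leqnn _)) rmorph_sum.
by apply: eq_bigr => i _; rewrite rmorphM rmorphXn.
Qed.

Lemma eq_ev1 (A S : comNzRingType) (f g : {rmorphism A -> S}) (s : S) :
  f =1 g -> ev1 f s =1 ev1 g s.
Proof.
move=> eq_fg p; rewrite (ev1E _ _ (leqnn _)) [RHS](ev1E _ _ (leqnn _)).
by apply: eq_bigr => i _; rewrite eq_fg.
Qed.

Definition ev2 (A S : comNzRingType) (f : {rmorphism A -> S}) (z t : S) :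
  {poly {poly A}} -> S := ev1 (ev1 f z) t.

HB.instance Definition _ A S f z t := GRing.RMorphism.on (@ev2 A S f z t).

Section Ev2.
Variables (A S : comNzRingType) (f : {rmorphism A -> S}) (z t : S).

Lemma ev2C a : ev2 f z t a%:P%:P = f a.
Proof. by rewrite /ev2 ev1C /= ev1C. Qed.

Lemma ev2z : ev2 f z t 'X%:P = z.
Proof. by rewrite /ev2 ev1C /= ev1X. Qed.

Lemma ev2t : ev2 f z t 'X = t.
Proof. by rewrite /ev2 ev1X. Qed.

Lemma ev2E n (g : {poly {poly A}}) :
    (size g <= n)%N -> (forall c, (size (g`_c)%R <= n)%N) ->
  ev2 f z t g = \sum_(c < n) \sum_(b < n) f g`_c`_b * z ^+ b * t ^+ c.
Proof.
move=> le_gn le_gcn; rewrite /ev2 (ev1E _ _ le_gn); apply: eq_bigr => c _.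
by rewrite /= (ev1E _ _ (le_gcn c)) mulr_suml.
Qed.
End Ev2.

Lemma bidegree_bound (A : nzRingType) (g : {poly {poly A}}) :
  exists n, (size g <= n)%N /\ forall c, (size (g`_c)%R <= n)%N.
Proof.
exists (size g + \max_(c < size g) size (g`_c)%R)%N; split; first exact: leq_addr.
move=> c; case: (ltnP c (size g)) => [lt_cg|le_gc].
  exact: leq_trans (leq_bigmax (Ordinal lt_cg)) (leq_addl _ _).
by rewrite [g`_c]nth_default // size_poly0.
Qed.

Lemma ev1_id (A : comNzRingType) (p : {poly A}) : ev1 (@polyC A) 'X p = p.
Proof.
rewrite (ev1E _ _ (leqnn _)) -[RHS]coefK poly_def.
by apply: eq_bigr => i _; rewrite mul_polyC.
Qed.

Lemma ev2_id (A : comNzRingType) (g : {poly {poly A}}) :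
  ev2 (polyC \o polyC) 'X%:P 'X g = g.
Proof.
rewrite -[RHS]ev1_id; apply: eq_ev1 => p /=.
by rewrite -[in RHS](ev1_id p) rmorph_ev1.
Qed.

Section Lift.
Variables (k : fieldType) (eta : {poly k}) (S : comNzRingType).
Variables (f : {rmorphism k -> S}) (v : 'I_4 -> S).
Hypothesis hv : v 0 ^+ 2 * v 1 + v 2%R ^+ 2 + v 3%R ^+ 3 + ev1 f (v 0) eta = 0.

Let lift (r : coord_ring eta) : S := mmap f v (repr r).

Let lift_class p : lift (coord_class eta p) = mmap f v p.
Proof.
apply/eqP; rewrite -subr_eq0 -mmapB /lift.
set q := repr _.
have : q - p \in defining_ideal eta.
  by rewrite Quotient.idealrBE; apply/eqP; rewrite /q reprK.
case/asboolP=> s ->; rewrite rmorphM /= -[X in _ * X]/(mmap f v _).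
suff -> : mmap f v (defining_poly eta) = 0 by rewrite mulr0.
have vX i : mmap f v 'X_i = v i by rewrite mmapX mmap1U.
rewrite /defining_poly !rmorphD rmorphM !rmorphXn /= !vX -hv; congr (_ + _).
rewrite -[_.['X_0]]/(ev1 (@mpolyC 4 k) 'X_0 eta) rmorph_ev1 /= vX.
by apply: eq_ev1 => a /=; rewrite mmapC.
Qed.

Lemma coord_lift : exists g : {rmorphism coord_ring eta -> S},
  (forall i, g (coord_class eta 'X_i) = v i) /\ (forall a, g a%:A = f a).
Proof.
have classK (r : coord_ring eta) : coord_class eta (repr r) = r by exact: reprK.
have lift_zmod : zmod_morphism lift.
  move=> r s; rewrite -(classK r) -(classK s).
  have -> : coord_class eta (repr r) - coord_class eta (repr s) =
    coord_class eta (repr r - repr s) by rewrite [RHS]rmorphB.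
  by rewrite !lift_class rmorphB.
have lift_monoid : monoid_morphism lift.
  split=> [|r s]; first by rewrite -(coord_class1 eta) lift_class rmorph1.
  by rewrite -(classK r) -(classK s) -coord_classM !lift_class rmorphM.
pose za := GRing.isZmodMorphism.Build _ _ lift lift_zmod.
pose ma := GRing.isMonoidMorphism.Build _ _ lift lift_monoid.
pose g : {rmorphism coord_ring eta -> S} := HB.pack lift za ma.
exists g; split=> [i|a]; first by rewrite [LHS]lift_class mmapX mmap1U.
by rewrite -coord_class_alg [LHS]lift_class mmapC.
Qed.
End Lift.

Lemma map_poly_ev1 (A S : comNzRingType) (f : {rmorphism A -> S}) (p : {poly A}) :
  map_poly f p = ev1 (polyC \o f) 'X p.
Proof.
rewrite (ev1E _ _ (leqnn _)); apply/polyP => i; rewrite coef_map coef_sum /=.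
rewrite -{1}(coefK p) poly_def coef_sum rmorph_sum; apply: eq_bigr => j _.
by rewrite coefZ coefCM rmorphM !coefXn rmorph_nat.
Qed.

Section Embeddings.
Variables (k : fieldType) (R : comAlgType k) (x y z t : R).
Local Notation C := {poly {poly k}}.

Definition kC : k -> C := polyC \o polyC.
HB.instance Definition _ := GRing.RMorphism.on kC.

(* In nested polynomials the innermost indeterminate is z, then t, x, y. *)
Definition embed_zt : C -> R := ev2 (in_alg R) z t.
HB.instance Definition _ := GRing.RMorphism.on embed_zt.

Definition embed_xzt : {poly C} -> R := ev1 embed_zt x.
HB.instance Definition _ := GRing.RMorphism.on embed_xzt.

Definition embed_xyzt : {poly {poly C}} -> R := ev1 embed_xzt y.
HB.instance Definition _ := GRing.RMorphism.on embed_xyzt.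

Lemma embed_zt_alg a : embed_zt (kC a) = a%:A.
Proof. exact: ev2C. Qed.

Lemma embed_zt_z : embed_zt 'X%:P = z.
Proof. exact: ev2z. Qed.

Lemma embed_zt_t : embed_zt 'X = t.
Proof. exact: ev2t. Qed.

Lemma embed_xztX : embed_xzt 'X = x.
Proof. exact: ev1X. Qed.

Lemma embed_xztC g : embed_xzt g%:P = embed_zt g.
Proof. exact: ev1C. Qed.

Lemma embed_xyztX : embed_xyzt 'X = y.
Proof. exact: ev1X. Qed.

Lemma embed_xyztC g : embed_xyzt g%:P = embed_xzt g.
Proof. exact: ev1C. Qed.

Definition zt_part (eta : {poly k}) : {poly C} :=
  ('X%:P ^+ 2 + 'X ^+ 3)%:P + map_poly kC eta.

(** Everything the argument uses of the coordinate ring. The universal property [pres_lift] yields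
    the morphism to a field of fractions that defines the x-degree. *)
Record presentation (eta : {poly k}) : Prop := Presentation {
  pres_surj : forall r, exists h, embed_xyzt h = r;
  pres_rel : x ^+ 2 * y = - embed_xzt (zt_part eta);
  pres_lift : forall (S : comNzRingType) (f : {rmorphism k -> S}) (x' y' z' t' : S),
    x' ^+ 2 * y' + z' ^+ 2 + t' ^+ 3 + ev1 f x' eta = 0 ->
    exists g : {rmorphism R -> S},
      [/\ g x = x', g y = y', g z = z', g t = t' & forall a, g a%:A = f a] }.
End Embeddings.

Section CoordRing.
Variables (k : fieldType) (eta : {poly k}).
Local Notation R := (coord_ring eta).
Local Notation C := {poly {poly k}}.

Lemma coord_class_zmod_morphism : zmod_morphism (@coord_class k eta).
Proof. by move=> p q; exact: (rmorphB (\pi_{ideal_quot (defining_ideal eta)})). Qed.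

Lemma coord_class_monoid_morphism : monoid_morphism (@coord_class k eta).
Proof. by split; [exact: coord_class1 | exact: coord_classM]. Qed.

HB.instance Definition _ := GRing.isZmodMorphism.Build {mpoly k[4]} R
  (@coord_class k eta) coord_class_zmod_morphism.
HB.instance Definition _ := GRing.isMonoidMorphism.Build {mpoly k[4]} R
  (@coord_class k eta) coord_class_monoid_morphism.

Local Notation x := (coord_class eta 'X_0).
Local Notation y := (coord_class eta 'X_1).
Local Notation z := (coord_class eta 'X_2).
Local Notation t := (coord_class eta 'X_3).

Lemma ord4P (P : 'I_4 -> Prop) : P 0 -> P 1 -> P 2%R -> P 3%R -> forall i, P i.
Proof.
move=> h0 h1 h2 h3 i.
have [] : [\/ i = 0, i = 1, i = 2%R | i = 3%R] => [|-> //|-> //|-> //|-> //].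
case: i => -[|[|[|[|//]]]] lti; [constructor 1|constructor 2|constructor 3|constructor 4];
  exact: val_inj.
Qed.

Lemma coord_embed_surj (r : R) : exists h, embed_xyzt x y z t h = r.
Proof.
have [p <-] : exists p, coord_class eta p = r by exists (repr r); exact: reprK.
exists (mmap (polyC \o polyC \o @kC k)
  (fun i => nth 0 [:: 'X%:P; 'X; 'X%:P%:P%:P; 'X%:P%:P] i) p).
rewrite [p in RHS]mpolyE /mmap !rmorph_sum; apply: eq_bigr => m _.
rewrite -mul_mpolyC !rmorphM /= coord_class_alg.
rewrite embed_xyztC embed_xztC -/(kC _) embed_zt_alg; congr (_ * _).
rewrite /mmap1 (mpolyXE_id _ m) !rmorph_prod; apply: eq_bigr => i _.
rewrite !rmorphXn; congr (_ ^+ _); move: i.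
apply: ord4P; rewrite /= ?embed_xyztX ?embed_xyztC ?embed_xztX ?embed_xztC //=.
  exact: embed_zt_z.
exact: embed_zt_t.
Qed.

Lemma coord_relation : x ^+ 2 * y = - embed_xzt x z t (zt_part eta).
Proof.
have : coord_class eta (defining_poly eta) = 0.
  apply/eqP; rewrite -(rmorph0 (@coord_class k eta)).
  rewrite -(Quotient.idealrBE (defining_ideal eta)) subr0.
  by apply/asboolP; exists 1; rewrite mul1r.
rewrite /defining_poly !rmorphD rmorphM !rmorphXn /= => /eqP.
rewrite -!addrA addr_eq0 => /eqP->; congr (- _).
rewrite /= !embed_xztC embed_zt_z embed_zt_t !addrA.
congr (_ + _); rewrite -[_.['X_0]]/(ev1 (@mpolyC 4 k) 'X_0 eta) [LHS]rmorph_ev1.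
rewrite map_poly_ev1.
rewrite (rmorph_ev1 (polyC \o @kC k) 'X (embed_xzt x z t) eta).
rewrite -[RHS]/(ev1 _ (embed_xzt x z t 'X) eta) embed_xztX.
apply: eq_ev1 => a.
rewrite [RHS]embed_xztC [RHS]embed_zt_alg.
exact: coord_class_alg.
Qed.

Lemma coord_presentation : presentation x y z t eta.
Proof.
split; [exact: coord_embed_surj | exact: coord_relation | move=> S f x' y' z' t' h].
pose v (i : 'I_4) := nth 0 [:: x'; y'; z'; t'] i.
by have [g [gv gk]] := @coord_lift k eta S f v h; exists g; rewrite !gv.
Qed.
End CoordRing.

(** * The x-adic filtration *)

Section Filtration.
Variables (C R : comNzRingType) (emb : {rmorphism C -> R}) (x y : R).
Local Notation embx := (ev1 emb x).
Local Notation embxy := (ev1 embx y).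

(* x has degree -1 and y degree 2. *)
Definition x_filtration (d : int) (r : R) : Prop :=
  exists2 h : {poly {poly C}}, embxy h = r &
    forall i j, d < (2 * i)%:Z - j%:Z -> h`_i`_j = 0.

Definition x_leading (e r : nat) (g : C) (a : R) : Prop :=
  g != 0 /\
  x_filtration ((2 * e)%:Z - r%:Z - 1) (a - y ^+ e * x ^+ r * emb g).

Lemma embed_monomial e r g :
  embxy ((g *: 'X^r) *: 'X^e) = y ^+ e * x ^+ r * emb g.
Proof.
rewrite -!mul_polyC !rmorphM !rmorphXn /= !ev1C /= !ev1X.
by rewrite ev1C mulrC [emb _ * _]mulrC mulrA.
Qed.

(** Since x has negative degree, the lowest power of x dominates. *)
Lemma x_leading_poly (q : {poly C}) : q != 0 ->
  exists r, x_leading 0 r q`_r (embx q) /\ (q`_0 != 0 -> r = 0%N).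
Proof.
move=> nzq; have exq : exists r, q`_r != 0.
  by exists (size q).-1; rewrite -lead_coefE lead_coef_eq0.
case: (ex_minnP exq) => r nzr minr; exists r; split; last first.
  by move=> /minr; rewrite leqn0 => /eqP.
split=> //; exists ((q - q`_r *: 'X^r)%:P).
  rewrite ev1C.
  rewrite rmorphB.
  rewrite -mul_polyC.
  rewrite rmorphM rmorphXn /= ev1C ev1X.
  by rewrite expr0 mul1r [x ^+ r * _]mulrC.
move=> i j; rewrite coefC; case: eqP => [->|_]; last by rewrite coef0.
rewrite muln0 => lt_j; have {lt_j} : (j <= r)%N by lia.
rewrite coefB coefZ coefXn leq_eqVlt => /orP[/eqP->|lt_jr].
  by rewrite eqxx mulr1 subrr.
rewrite (ltn_eqF lt_jr) mulr0 subr0; apply/eqP; apply: contraTT lt_jr => /minr.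
by rewrite -leqNgt.
Qed.

(** Induction on the y-degree. If the coefficient of y^(n+1) contains x^0 or x^1, that term has
    degree at least 2n + 1 and outweighs every y^i with i <= n. Otherwise x^2 divides the
    coefficient, and x^2 y = - G lowers the y-degree. *)
Lemma leading_exists (G : {poly C}) (a : R) :
    (forall r, exists h, embxy h = r) -> x ^+ 2 * y = - embx G ->
   (exists q, a = embx q) \/
  exists e r g, [/\ (0 < e)%N, (r <= 1)%N & x_leading e r g a].
Proof.
move=> surj rel; have [h <-] := surj a.
have [n] := ubnP (size h); elim: n => // n IHn in h * => le_hn.
case: n => [|[|n]] in IHn le_hn.
- by left; exists 0; move: le_hn; rewrite ltnS leqn0 size_poly_eq0 => /eqP->; rewrite !rmorph0.
- left; exists h`_0; rewrite -(ev1C embx y); congr (embxy _).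
  by apply: size1_polyC.
set q := h`_n.+1.
have hE : embxy h = embxy (take_poly n.+1 h) +
    embx q * y ^+ n.+1.
  rewrite -{1}(poly_take_drop n.+1 h) rmorphD rmorphM rmorphXn /= ev1X.
  congr (_ + _ * _); rewrite -(ev1C embx y); congr (embxy _).
  rewrite [LHS]size1_polyC ?coef_drop_poly ?add0n //.
  by rewrite size_drop_poly leq_subLR addn1.
have [q0|nzq0] := eqVneq q`_0 0; last first.
  right; exists n.+1, 0%N, q`_0; split=> //; split=> //.
  rewrite -embed_monomial -rmorphB; eexists; first reflexivity.
  move=> i j lt_ij; rewrite !coefB !coefZ !coefXn.
  have [eq_i|ne_i] := eqVneq i n.+1.
    rewrite {}eq_i in lt_ij *.
    have [->|ne_j] := eqVneq j 0%N; last lia.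
    by rewrite mulr1 coefZ coefXn mulr1 subrr.
  have le_i : (n.+2 <= i)%N by lia.
  have -> : h`_i = 0 by exact: nth_default (leq_trans (ltnSE le_hn) le_i).
  by rewrite mulr0 !coef0 subr0.
have [q1|nzq1] := eqVneq q`_1 0; last first.
  right; exists n.+1, 1%N, q`_1; split=> //; split=> //.
  rewrite -embed_monomial -rmorphB; eexists; first reflexivity.
  move=> i j lt_ij; rewrite !coefB !coefZ !coefXn.
  have [eq_i|ne_i] := eqVneq i n.+1.
    rewrite {}eq_i in lt_ij *.
    rewrite mulr1 coefZ coefXn; case: j lt_ij => [|[|j]] lt_ij; last lia.
      by rewrite mulr0 subr0.
    by rewrite mulr1 subrr.
  have le_i : (n.+2 <= i)%N by lia.
  have -> : h`_i = 0 by exact: nth_default (leq_trans (ltnSE le_hn) le_i).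
  by rewrite mulr0 !coef0 subr0.
have qE : q = drop_poly 2 q * 'X^2.
  rewrite -{1}(poly_take_drop 2 q) -[RHS]add0r; congr (_ + _).
  apply/polyP => i; rewrite coef_take_poly coef0.
  by case: i => [|[|i]].
pose h' := take_poly n.+1 h - (G * drop_poly 2 q) *: 'X^n.
have -> : embxy h = embxy h'.
  rewrite hE rmorphB; congr (_ + _); rewrite -mul_polyC rmorphM rmorphXn /=.
  rewrite ev1C ev1X [in LHS]qE rmorphM rmorphXn /= ev1X.
  have -> : embx (drop_poly 2 q) * x ^+ 2 * y ^+ n.+1 =
    (x ^+ 2 * y) * embx (drop_poly 2 q) * y ^+ n by rewrite [y ^+ _]exprS; ring.
  by rewrite rel rmorphM /= !mulNr.
apply: IHn; rewrite ltnS; apply: leq_trans (size_polyD _ _) _.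
rewrite size_polyN geq_max size_take_poly /=.
by apply: leq_trans (size_scale_leq _ _) _; rewrite size_polyXn.
Qed.

Section TopOnFiltration.
Variables (S : comNzRingType) (T : int -> R -> S -> Prop).
Hypothesis hT : top_rel int_pos T.
Variables (L : nat) (psi : {rmorphism C -> S}) (px py : S).
Hypotheses (L_gt0 : (0 < L)%N) (Tx : T (- L%:Z) x px) (Ty : T (L%:Z *+ 2) y py).
Hypothesis Tzt : forall g, T 0 (emb g) (psi g).

Lemma top_monomial e r g :
  T (L%:Z * ((2 * e)%:Z - r%:Z)) (y ^+ e * x ^+ r * emb g)
    (py ^+ e * px ^+ r * psi g).
Proof.
have -> : L%:Z * ((2 * e)%:Z - r%:Z) = L%:Z *+ 2 *+ e + (- L%:Z) *+ r + 0.
  by rewrite -mulrnA -[_ *+ (2 * e)]mulr_natr -[_ *+ r]mulr_natr !natz; ring.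
by apply: (topM hT) (Tzt g); apply: (topM hT); apply: (topX hT).
Qed.

Lemma top_filtration d a : x_filtration d a -> exists P, T (L%:Z * d) a P.
Proof.
case=> h <- hd; rewrite [embxy h](ev1E _ _ (leqnn _)).
elim/big_ind: _ => [|a1 a2 [P1 h1] [P2 h2]|i _].
- by exists 0; exact: top0 hT _.
- by exists (P1 + P2); apply: (topD hT).
rewrite /= (ev1E _ _ (leqnn _)) mulr_suml.
elim/big_ind: _ => [|a1 a2 [P1 h1] [P2 h2]|j _].
- by exists 0; exact: top0 hT _.
- by exists (P1 + P2); apply: (topD hT).
have -> : emb (h`_i)`_j * x ^+ j * y ^+ i =
  y ^+ i * x ^+ j * emb (h`_i)`_j by ring.
have Tij := top_monomial i j (h`_i)`_j.
have [lt_d|] := ltrP d ((2 * i)%:Z - j%:Z).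
  by exists 0; rewrite hd // rmorph0 mulr0; exact: top0 hT _.
rewrite le_eqVlt => /orP[/eqP <-|lt_ij]; first by eexists; exact: Tij.
by exists 0; apply: (top_lower hT Tij); rewrite /int_pos; nia.
Qed.

Lemma top_leading e r g a : x_leading e r g a ->
  T (L%:Z * ((2 * e)%:Z - r%:Z)) a (py ^+ e * px ^+ r * psi g).
Proof.
case=> _ /top_filtration[P hP].
rewrite -[a](subrK (y ^+ e * x ^+ r * emb g)) -[X in T _ _ X]add0r.
apply: (topD hT) (top_monomial e r g).
by apply: (top_lower hT hP); rewrite /int_pos; nia.
Qed.
End TopOnFiltration.

End Filtration.

Lemma top_ev2 (G : zmodType) pos (A R S : comNzRingType) (T : G -> R -> S -> Prop)
    (f : {rmorphism A -> R}) (f' : {rmorphism A -> S}) z t z' t' :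
  top_rel pos T -> (forall a, T 0 (f a) (f' a)) -> T 0 z z' -> T 0 t t' ->
  forall g, T 0 (ev2 f z t g) (ev2 f' z' t' g).
Proof.
move=> hT hk hz ht g; have [n [le_gn le_gcn]] := bidegree_bound g.
rewrite !(ev2E _ _ _ le_gn le_gcn).
apply: (top_sum hT) => c _; apply: (top_sum hT) => b _.
rewrite -[0 : G]addr0; apply: (topM hT); last first.
  by rewrite -(mul0rn _ c); apply: (topX hT).
rewrite -[0 : G]addr0; apply: (topM hT) => //.
by rewrite -(mul0rn _ b); apply: (topX hT).
Qed.

(** * The weight of U *)

Section Slope.
Variables (A C : comNzRingType) (T : nat -> int -> A -> C -> Prop).
Hypothesis hT : forall L, (0 < L)%N -> top_rel int_pos (T L).
Hypothesis degree : forall a : A, a != 0 ->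
  exists d : int, forall L, (0 < L)%N -> exists2 c : C, c != 0 & T L (L%:Z * d) a c.

(** The ratio u / L is the least value of (d - deg a_n) / n over the nonzero coefficients a_n with n
    > 0. Minimality keeps every coefficient within its bound, and a coefficient attaining the
    minimum survives, so some leading part is not constant. *)
Lemma slope_exists (s : seq ({poly A} * int)) :
  (forall p : {poly A} * int, p \in s -> forall L, (0 < L)%N -> exists c, T L (L%:Z * p.2) p.1`_0 c) ->
  (exists2 p : {poly A} * int, p \in s & (1 < size p.1)%N) ->
  exists L u, [/\ (0 < L)%N,
    forall p, p \in s ->
      exists P : {poly C}, forall n, T L (L%:Z * p.2 - u *+ n) p.1`_n P`_n &
    exists p (P : {poly C}), [/\ p \in s, (1 < size P)%N &
      forall n, T L (L%:Z * p.2 - u *+ n) p.1`_n P`_n]].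
Proof.
move=> h0 [[p0 d0] p0s lt1].
(* At a = 0 the degree 0 is a placeholder, guarded by [a != 0]. *)
have /choice[deg hdeg] : forall a : A, exists d : int, a != 0 ->
    forall L, (0 < L)%N -> exists2 c : C, c != 0 & T L (L%:Z * d) a c.
  by move=> a; have [->|/degree[d hd]] := eqVneq a 0; [exists 0 | exists d].
pose slopes (p : {poly A} * int) := [seq (n, deg p.1`_n - p.2) |
  n <- iota 1 (size p.1) & p.1`_n != 0].
have slopesP (p : {poly A} * int) q : q \in slopes p -> exists2 n, (0 < n)%N /\ p.1`_n != 0 &
    q = (n, deg p.1`_n - p.2).
  by case/mapP=> n; rewrite mem_filter mem_iota => /andP[nz /andP[n1 _]] ->; exists n.
have mem_slopes (p : {poly A} * int) n : (0 < n)%N -> p.1`_n != 0 -> (n, deg p.1`_n - p.2) \in slopes p.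
  move=> n0 nz; apply/mapP; exists n => //; rewrite mem_filter nz mem_iota n0 /=.
  rewrite addSn ltnS leqNgt; apply/negP => lt_n; move/eqP: nz; apply.
  exact: nth_default (ltnW lt_n).
have [L [u [L0 hu [q]]]] : exists (L : nat) (u : int), [/\ (0 < L)%N,
    (forall p, p \in flatten (map slopes s) -> L%:Z * p.2 + u *+ p.1 <= 0) &
    exists2 p, p \in flatten (map slopes s) & L%:Z * p.2 + u *+ p.1 = 0].
  apply: max_slope.
    suff : ((size p0).-1, deg p0`_(size p0).-1 - d0) \in flatten (map slopes s).
      by case: flatten.
    apply/flatten_mapP; exists (p0, d0) => //; apply: (mem_slopes (p0, d0)) => /=.
      by case: (size p0) lt1 => [|[]].
    by rewrite -lead_coefE lead_coef_eq0 -size_poly_eq0; case: (size p0) lt1.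
  by apply/allP => r /flatten_mapP[p ps /slopesP[n [n0 _] ->]].
case/flatten_mapP=> p1 p1s /slopesP[n1 [n1_gt0 nz1] ->] /= eq1.
have rel (p : {poly A} * int) : p \in s -> exists P : {poly C},
    (forall n, T L (L%:Z * p.2 - u *+ n) p.1`_n P`_n) /\
    forall n, (0 < n)%N -> p.1`_n != 0 ->
      L%:Z * (deg p.1`_n - p.2) + u *+ n = 0 -> P`_n != 0.
  (* The component is given by [h0] for n = 0, is the leading coefficient of a_n where the extremal
     slope is attained, and is 0 elsewhere. *)
  move=> ps; pose good n (c : C) := T L (L%:Z * p.2 - u *+ n) p.1`_n c /\
    ((0 < n)%N -> p.1`_n != 0 -> L%:Z * (deg p.1`_n - p.2) + u *+ n = 0 -> c != 0).
  have /choice[c hc] : forall n, exists c, good n c.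
    move=> n; rewrite /good.
    have [->|n0] := posnP n.
      have [c hc] := h0 _ ps L L0.
      by exists c; split=> //; rewrite mulr0n subr0.
    have [->|nz] := eqVneq p.1`_n 0.
      by exists 0; split; [exact: top0 (hT L0) _ | rewrite eqxx].
    have [c nzc hc] := hdeg _ nz _ L0.
    have := hu (n, deg p.1`_n - p.2); rewrite /= le_eqVlt => /(_ _)/orP[|/eqP eqn|ltn].
    - by apply/flatten_mapP; exists p => //; exact: mem_slopes.
    - exists c; split=> //; suff <- : L%:Z * deg p.1`_n = L%:Z * p.2 - u *+ n by [].
      by move: (u *+ n) (deg _) eqn => m d eqn; lia.
    - exists 0; split=> [|_ _ eqn]; last by move: ltn; rewrite eqn ltxx.
      by apply: (top_lower (hT L0) hc); rewrite /int_pos; move: (u *+ n) (deg _) ltn => m d; lia.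
  exists (\poly_(i < size p.1) c i); split=> n; rewrite coef_poly; case: (ltnP n (size p.1)) => lt_n.
  - by have [h1 h2] := hc n.
  - by rewrite nth_default //; exact: top0 (hT L0) _.
  - by have [h1 h2] := hc n.
  - by move=> _; rewrite nth_default // eqxx.
exists L, u; split=> // [p /rel[P [hP _]]|]; first by exists P.
have [P [hP nzP]] := rel _ p1s; exists p1, P; split=> //.
rewrite ltnNge; apply/negP => le1; move/eqP: (nzP _ n1_gt0 nz1 eq1); apply.
exact: nth_default (leq_trans le1 n1_gt0).
Qed.
End Slope.

(** * Weighted forms and the cuspidal equation *)

Lemma coef_exp_top (D : comNzRingType) (P : {poly D}) m n :
  (size P <= m.+1)%N ->
  (size (P ^+ n) <= (m * n).+1)%N /\ (P ^+ n)`_(m * n) = P`_m ^+ n.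
Proof.
move=> le_Pm; elim: n => [|n [le_n IHn]].
  by rewrite !expr0 muln0 size_poly1 coef1.
rewrite !exprS mulnS; split.
  by apply: leq_trans (size_polyMleq _ _) _; lia.
have lt_m : (m < (m + m * n).+1)%N by rewrite ltnS leq_addr.
rewrite coefM (bigD1 (Ordinal lt_m)) //= addKn IHn big1 ?addr0 //.
move=> i ne_im; have [lt_im|gt_im|eq_im] := ltngtP i m.
- rewrite [X in _ * X]nth_default ?mulr0 //; apply: leq_trans le_n _; lia.
- by rewrite nth_default ?mul0r // (leq_trans le_Pm).
by case/eqP: ne_im; exact: val_inj.
Qed.

Lemma coefM_top (D : comNzRingType) (P Q : {poly D}) m n :
  (size P <= m.+1)%N -> (size Q <= n.+1)%N ->
  (size (P * Q)%R <= (m + n).+1)%N /\ (P * Q)`_(m + n) = P`_m * Q`_n.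
Proof.
move=> le_Pm le_Qn; split.
  by apply: leq_trans (size_polyMleq _ _) _; lia.
have lt_m : (m < (m + n).+1)%N by rewrite ltnS leq_addr.
rewrite coefM (bigD1 (Ordinal lt_m)) //= addKn big1 ?addr0 //.
move=> i ne_im; have [lt_im|gt_im|eq_im] := ltngtP i m.
- rewrite [X in _ * X]nth_default ?mulr0 //; apply: leq_trans le_Qn _; lia.
- by rewrite nth_default ?mul0r // (leq_trans le_Pm).
by case/eqP: ne_im; exact: val_inj.
Qed.

Section WeightedForms.
Variable k : fieldType.

Definition weighted_form (w : nat) (g : {poly {poly k}}) : Prop :=
  forall b c, g`_c`_b != 0 -> (3 * b + 2 * c)%N = w.

(* Modulo z^2 + t^3, all monomials of weight w are equal up to sign. *)
Lemma weighted_form_cusp w g : weighted_form w g -> exists a e c0,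
  forall (S : comNzRingType) (f : {rmorphism k -> S}) (z t : S),
    exists h, ev2 f z t g = f a * z ^+ e * t ^+ c0 + (z ^+ 2 + t ^+ 3) * h.
Proof.
move=> wg; have [n [le_gn le_gcn]] := bidegree_bound g.
(* In weight w the exponent b has the parity of w, and z^2 = - t^3 on the cusp, so z^b t^c reduces
   to z^(odd w) t^c0 with sign (-1)^(b./2). *)
exists (\sum_(c < n) \sum_(b < n) g`_c`_b * (-1) ^+ b./2), (odd w : nat),
  ((w - 3 * odd w)./2)%N => S f z t.
rewrite (ev2E _ _ _ le_gn le_gcn) rmorph_sum !mulr_suml.
elim/big_ind2: _ => [|u1 v1 u2 v2 [h1 ->] [h2 ->]|c _].
- by exists 0; rewrite mulr0 addr0.
- by exists (h1 + h2); rewrite mulrDr addrACA.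
rewrite rmorph_sum !mulr_suml.
elim/big_ind2: _ => [|u1 v1 u2 v2 [h1 ->] [h2 ->]|b _].
- by exists 0; rewrite mulr0 addr0.
- by exists (h1 + h2); rewrite mulrDr addrACA.
have [->|nz] := eqVneq g`_c`_b 0.
  by exists 0; rewrite mul0r rmorph0 !mul0r mulr0 addr0.
have eqw := wg _ _ nz.
have -> : odd w = odd b by rewrite -eqw oddD !oddM /= addbF.
have -> : ((w - 3 * odd b)./2 = c + 3 * b./2)%N.
  by rewrite -eqw; have := odd_double_half b; lia.
have [h hE] : exists h, z ^+ (b./2).*2 = (- t ^+ 3) ^+ b./2 + (z ^+ 2 + t ^+ 3) * h.
  exists (\sum_(i < b./2) (z ^+ 2) ^+ (b./2.-1 - i) * (- t ^+ 3) ^+ i).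
  rewrite -mul2n exprM.
  have -> : z ^+ 2 + t ^+ 3 = z ^+ 2 - (- t ^+ 3) by rewrite opprK.
  by rewrite -subrXX addrC subrK.
exists (f g`_c`_b * z ^+ odd b * t ^+ c * h).
have -> : z ^+ b = z ^+ odd b * z ^+ (b./2).*2 by rewrite -exprD odd_double_half.
rewrite hE [(- t ^+ 3) ^+ _]exprNn -[(t ^+ 3) ^+ _]exprM exprD rmorphM rmorphXn rmorphN1; ring.
Qed.

Variables (D : idomainType) (f : {rmorphism k -> D}).
Local Notation fP := (polyC \o f).

Section Substitution.
Variables (P Q : {poly D}) (j l : nat).
Hypotheses (Pj : (size P <= j.+1)%N) (Ql : (size Q <= l.+1)%N).

Lemma coef_monomial a b c :
  (size (fP a * P ^+ b * Q ^+ c)%R <= (j * b + l * c).+1)%N /\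
  (fP a * P ^+ b * Q ^+ c)`_(j * b + l * c) = f a * P`_j ^+ b * Q`_l ^+ c.
Proof.
have [s1 c1] := coef_exp_top b Pj; have [s2 c2] := coef_exp_top c Ql.
have [s3 c3] := coefM_top s1 s2.
rewrite -mulrA mul_polyC coefZ c3 c1 c2 mulrA; split=> //.
exact: leq_trans (size_scale_leq _ _) s3.
Qed.

(** Replacing z^2 by t^3 keeps the weight and, as 2j < 3l, raises the U-degree j b + l c. So the
    monomial with the largest c cannot cancel, and it is constant only when b = c = 0. *)
Lemma weighted_form_const_lt w g : weighted_form w g -> g != 0 ->
  P`_j != 0 -> Q`_l != 0 -> (0 < j)%N -> (j * 2 < l * 3)%N ->
  (size (ev2 fP P Q g) <= 1)%N -> w = 0%N.
Proof.
move=> wg nzg nzP nzQ j0 lt_jl; have l0 : (0 < l)%N by case: (l) lt_jl.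
have [n [le_gn le_gcn]] := bidegree_bound g.
rewrite (ev2E _ _ _ le_gn le_gcn) => le1.
pose c0 := (size g).-1; pose b0 := (size (g`_c0)%R).-1.
have nzgc : g`_c0 != 0 by rewrite -lead_coefE lead_coef_eq0.
have nzgcb : g`_c0`_b0 != 0 by rewrite -lead_coefE lead_coef_eq0.
have lt_cn : (c0 < n)%N by apply: leq_trans le_gn; rewrite prednK // size_poly_gt0.
have lt_bn : (b0 < n)%N.
  by apply: leq_trans (le_gcn c0); rewrite prednK // size_poly_gt0.
have eqw := wg _ _ nzgcb.
have le_c b c : g`_c`_b != 0 -> (c <= c0)%N.
  apply: contraNT; rewrite -ltnNge /c0 => lt_c.
  by rewrite [g`_c]nth_default ?coef0 // (leq_trans _ lt_c) // leqSpred.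
suff nz : (\sum_(c < n) \sum_(b < n) fP g`_c`_b * P ^+ b * Q ^+ c)`_(j * b0 + l * c0) != 0.
  have : (j * b0 + l * c0 < 1)%N.
    apply: leq_trans le1; rewrite ltnNge; apply: contra nz => le_sz.
    by rewrite nth_default.
  by rewrite ltnS leqn0 addn_eq0 !muln_eq0; lia.
rewrite coef_sum (bigD1 (Ordinal lt_cn)) //= coef_sum (bigD1 (Ordinal lt_bn)) //=.
rewrite (coef_monomial _ _ _).2 !big1 ?addr0.
- by rewrite !mulf_neq0 ?expf_neq0 // fmorph_eq0.
- move=> c ne_c; rewrite coef_sum big1 // => b _.
  have [->|nz] := eqVneq g`_c`_b 0; first by rewrite /= rmorph0 !mul0r coef0.
  rewrite nth_default //; apply: leq_trans (coef_monomial _ _ _).1 _.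
  have lt_c : (c < c0)%N.
    rewrite ltn_neqAle (le_c _ _ nz) andbT; apply: contra ne_c => /eqP e.
    exact/eqP/val_inj.
  have eqw' := wg _ _ nz.
  have : (3 * (j * b + l * c) < 3 * (j * b0 + l * c0))%N.
    rewrite !mulnDr !(mulnCA 3 j) !(mulnCA 3 l).
    have -> : (3 * b = 3 * b0 + 2 * (c0 - c))%N by lia.
    have -> : c0 = (c + (c0 - c))%N by lia.
    rewrite addKn; nia.
  by rewrite ltn_mul2l.
- move=> b ne_b; have [->|nz] := eqVneq g`_c0`_b 0; first by rewrite /= rmorph0 !mul0r coef0.
  have := wg _ _ nz; rewrite -eqw => eq_b; case/eqP: ne_b; apply: val_inj => /=; lia.
Qed.

(** All monomials of weight w now have U-degree l w / 2. If w > 0, constancy makes g vanish at the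
    pair of top coefficients, a point of the cusp with nonzero coordinates. By [weighted_form_cusp]
    the value of g is then a multiple of P^2 + Q^3, which is not constant. *)
Lemma weighted_form_const_eq w g : weighted_form w g -> g != 0 ->
  P`_j != 0 -> Q`_l != 0 -> (0 < j)%N -> (j * 2 = l * 3)%N ->
  P`_j ^+ 2 + Q`_l ^+ 3 = 0 -> ev2 fP P Q g != 0 ->
  (size (ev2 fP P Q g) <= 1)%N -> (1 < size (P ^+ 2 + Q ^+ 3)%R)%N -> w = 0%N.
Proof.
move=> wg nzg nzP nzQ j0 eq_jl eqPQ nzev le1 gt1.
have l0 : (0 < l)%N by lia.
have [//|w0] := posnP w.
have [a [e [c0 hcusp]]] := weighted_form_cusp wg.
have [n [le_gn le_gcn]] := bidegree_bound g.
(* From 2j = 3l and j > 0 one gets l >= 2, so the index l w / 2 is positive. *)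
have ev0 : ev2 f P`_j Q`_l g = 0.
  have : (ev2 fP P Q g)`_(l * w)./2 = 0.
    apply: nth_default; apply: leq_trans le1 _.
    have : (1 < l)%N by lia.
    nia.
  apply: etrans; rewrite (ev2E f _ _ le_gn le_gcn) (ev2E fP _ _ le_gn le_gcn) coef_sum.
  apply: eq_bigr => c _.
  rewrite coef_sum; apply: eq_bigr => b _.
  have [->|nz] := eqVneq g`_c`_b 0; first by rewrite /= !rmorph0 !mul0r coef0.
  have -> : ((l * w)./2 = j * b + l * c)%N by have := wg _ _ nz; nia.
  by rewrite (coef_monomial _ _ _).2.
have [h hh] := hcusp D f P`_j Q`_l.
move: hh; rewrite ev0 eqPQ mul0r addr0 => /esym/eqP.
rewrite !mulf_eq0 !expf_eq0 (negPf nzP) (negPf nzQ) !andbF !orbF fmorph_eq0 => /eqP a0.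
have [h' hh'] := hcusp _ fP P Q.
move: hh' nzev le1; rewrite a0 /= rmorph0 !mul0r add0r => ->.
rewrite mulf_eq0 negb_or => /andP[nz1 nz2]; rewrite size_mul // => le1.
rewrite -size_poly_gt0 in nz2; have := leq_add gt1 nz2; by case: (_ + _)%N le1 => [|[|[|s]]].
Qed.
End Substitution.
End WeightedForms.

Lemma predn_add_eq1 (a b : nat) :
  (0 < a)%N -> (0 < b)%N -> (a + b).-1 = 1%N -> a = 1%N /\ b = 1%N.
Proof. lia. Qed.

Lemma lt_of_ratio (a b : nat) : (a * 2 = b * 3 -> 0 < a -> b < a)%N.
Proof. lia. Qed.

Lemma size_gt1_exp (D : idomainType) (P : {poly D}) m n :
  size P = m.+1 -> (0 < m)%N -> (0 < n)%N -> (1 < size (P ^+ n))%N.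
Proof.
move=> szP m0 n0; have := size_exp P n; rewrite szP /=.
case: (size _) => [|[|s]] //= /eqP; rewrite eq_sym muln_eq0.
  by case: m n m0 n0 {szP} => [|m] [|n].
by case: m n m0 n0 {szP} => [|m] [|n].
Qed.

(** The two equations come from x, of odd degree -1, and z, of degree 0. Powers of y have even
    degree, so equal U-weights m would give 2e' - 2e = 1. *)
Lemma parity_absurd (L e e' : nat) (m : int) : (0 < L)%N ->
  L%:Z * (2 * e)%:Z = L%:Z * -1 - m -> L%:Z * (2 * e')%:Z = L%:Z * 0 - m -> False.
Proof.
move=> L0 eq1 eq2.
have /eqP : L%:Z * ((2 * e')%:Z - (2 * e)%:Z - 1) = 0 by rewrite !mulrBr eq1 eq2; ring.
by rewrite mulf_eq0; lia.
Qed.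

(** Weight minus three times the x-degree is 0 on y, whose degrees are 6 and 2, and is 3 on both x
    and z. With [theta] the resulting weight of U, scaled by L1 L2, i and j solve the same linear
    equation. *)
Lemma weights_determine (L1 L2 e e' i j : nat) (u1 u2 : int) :
  (0 < L1)%N -> (0 < L2)%N ->
  L1%:Z * (2 * e)%:Z = L1%:Z * -1 - u1 *+ i ->
  L2%:Z * ((6 * e)%:Z + 0%:Z) = L2%:Z * 0 - u2 *+ i ->
  L1%:Z * (2 * e')%:Z = L1%:Z * 0 - u1 *+ j ->
  L2%:Z * ((6 * e')%:Z + 0%:Z) = L2%:Z * 3 - u2 *+ j -> i = j.
Proof.
have mulE (u : int) (n : nat) : u *+ n = u * n%:Z by rewrite -mulr_natr natz.
rewrite !mulE => L1_gt0 L2_gt0 eq1 eq2 eq1' eq2'.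
pose theta := L1%:Z * u2 - 3 * L2%:Z * u1.
have hi : i%:Z * theta = 3 * L1%:Z * L2%:Z.
  have -> : i%:Z * theta = L1%:Z * (u2 * i%:Z) - 3 * L2%:Z * (u1 * i%:Z) by rewrite /theta; ring.
  have -> : u2 * i%:Z = - (L2%:Z * (6 * e)%:Z) by lia.
  have -> : u1 * i%:Z = - L1%:Z - L1%:Z * (2 * e)%:Z by lia.
  by rewrite !PoszM; ring.
have hj : j%:Z * theta = 3 * L1%:Z * L2%:Z.
  have -> : j%:Z * theta = L1%:Z * (u2 * j%:Z) - 3 * L2%:Z * (u1 * j%:Z) by rewrite /theta; ring.
  have -> : u2 * j%:Z = L2%:Z * 3 - L2%:Z * (6 * e')%:Z by lia.
  have -> : u1 * j%:Z = - (L1%:Z * (2 * e')%:Z) by lia.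
  by rewrite !PoszM; ring.
have nz_theta : theta != 0.
  by apply/eqP => th0; move: hi; rewrite th0 mulr0; nia.
by have /(mulIf nz_theta)[] : i%:Z * theta = j%:Z * theta by rewrite hi hj.
Qed.

(** * Constancy of Qx, Qz and Qt *)

Section LeadingForms.
Variable k : fieldType.
Local Notation C := {poly {poly k}}.
Local Notation z := ('X%:P : C).
Local Notation t := ('X : C).
Local Notation p := (z ^+ 2 + t ^+ 3).

(** The derivative in z gives 2 t z = 0, hence 2 = 0. The derivative in t gives 3 z^2 = 0 for either
    value of c, hence 3 = 0, and 1 = 3 - 2. *)
Lemma cusp_const_absurd (c : C) : c = z ^+ 2 \/ c = p ->
  t * map_poly deriv c = 3%:R * c * map_poly deriv t ->
  t * deriv c = 3%:R * c * deriv t -> False.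
Proof.
have dzC (q : {poly k}) : map_poly deriv (q%:P : C) = (deriv q)%:P.
  by rewrite map_polyC.
have dzXn n : map_poly deriv ('X ^+ n : C) = 0.
  by apply/polyP => i; rewrite coef_map coefXn coef0 /=; case: eqP => _; rewrite -polyC_natr derivC.
have z2 : z ^+ 2 = ('X ^+ 2)%:P :> C by rewrite polyC_exp.
move=> hc; have -> : map_poly deriv c = ('X *+ 2)%:P.
  case: hc => ->; rewrite z2; first by rewrite dzC derivXn.
  by rewrite raddfD /= dzC dzXn derivXn addr0.
have -> : map_poly deriv t = 0 :> C by rewrite -['X]expr1 dzXn.
rewrite mulr0 mulrC => /(congr1 (fun q : C => q`_1`_1)).
rewrite coefCM coefX mulr1 coefMn coefX !coef0 => two0.
have -> : 3%:R * c * deriv t = 3%:R * c by rewrite derivX mulr1.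
have -> : t * deriv c = 3%:R * (c - z ^+ 2).
  case: hc => ->; rewrite z2 ?derivD derivC ?subrr ?mulr0 // derivXn add0r.
  by rewrite addrC addKr -mulr_natl mulrCA -exprS.
move/eqP; rewrite -subr_eq0 -mulrBr addrAC subrr add0r mulrN oppr_eq0 z2.
rewrite -[3%:R]polyC_natr -[_%:R in X in X * _]polyC_natr -!polyCM => /eqP.
move/(congr1 (fun q : C => q`_0`_2)); rewrite coefC /= coefCM coefXn mulr1 !coef0 => three0.
have : 1 = 0 :> k by rewrite -[RHS]subr0 -{1}three0 -two0 eqxx /=; ring.
by move/eqP; rewrite oner_eq0.
Qed.

(** Both derivations of the coefficients are applied: [map_poly deriv] is d/dz, inconclusive in
    characteristic 2, and [deriv] is d/dt, inconclusive in characteristic 3. *)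
Lemma cusp_solution_absurd (a c : C) (P Q : {poly C}) :
  a%:P * P ^+ 2 = c%:P + Q ^+ 3 -> (size Q < size P)%N ->
  Q`_0 = t \/ Q`_0 = - t -> c = z ^+ 2 \/ c = p -> False.
Proof.
move=> eqPQ lt_size hQ /cusp_const_absurd.
have dtM (g h : C) : deriv (g * h) = deriv g * h + g * deriv h by exact: derivM.
have dzM (g h : C) : map_poly deriv (g * h) = map_poly deriv g * h + g * map_poly deriv h.
  by apply: map_polyM_der => g' h'; exact: derivM.
have := cusp_derivation dtM eqPQ lt_size; have := cusp_derivation dzM eqPQ lt_size.
case: hQ => -> /= h1 h2; first by apply.
apply; apply: oppr_inj; first by rewrite -mulNr h1 raddfN mulrN.
by rewrite -mulNr h2 raddfN mulrN.
Qed.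

Lemma cusp_neq0 : p != 0.
Proof.
apply/eqP => /(congr1 (fun q : C => q`_3)); rewrite coefD coefXn -polyC_exp coefC /= add0r coef0.
by move/eqP; rewrite oner_eq0.
Qed.

Section Core.
Variables (L1 L2 : nat) (u1 u2 : int) (Qx Qz Qt : {poly C}).
Hypotheses (L1_gt0 : (0 < L1)%N) (L2_gt0 : (0 < L2)%N).
Hypotheses (Qx0 : Qx`_0 = 1) (Qz0 : Qz`_0 = z) (Qt0 : Qt`_0 = t).
Hypothesis relQ : p%:P * Qx ^+ 2 = Qz ^+ 2 + Qt ^+ 3.
Local Notation ev := (ev2 (polyC \o @kC k) Qz Qt).

(** With P the leading part of phi(a), for a = x or z, and n its U-degree, P_n is the leading form
    of D_n(a). The induced map on leading forms fixes it, which is the first equation; the others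
    compute its two degrees in two ways. *)
Definition leading_data (P : {poly C}) (n : nat) (d0 e0 : int) : Prop :=
  exists e r w g, [/\ weighted_form w g,
    (P`_n)%:P = (- p)%:P ^+ e * Qx ^+ r * ev g,
    L1%:Z * ((2 * e)%:Z - r%:Z) = L1%:Z * d0 - u1 *+ n &
    L2%:Z * ((6 * e)%:Z + w%:Z) = L2%:Z * e0 - u2 *+ n].

Variables (i j l : nat).
Hypotheses (sizex : size Qx = i.+1) (sizez : size Qz = j.+1) (sizet : size Qt = l.+1).
Hypotheses (datax : leading_data Qx i (-1) 0) (dataz : leading_data Qz j 0 3).

Let nz_p : p != 0. Proof. exact: cusp_neq0. Qed.

Let nz_top (P : {poly C}) n : size P = n.+1 -> P`_n != 0.
Proof. by move=> szP; rewrite -[n]/(n.+1.-1) -szP -lead_coefE lead_coef_eq0 -size_poly_gt0 szP. Qed.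

Let nzX : Qx`_i != 0. Proof. exact: nz_top sizex. Qed.
Let nzZ : Qz`_j != 0. Proof. exact: nz_top sizez. Qed.
Let nzT : Qt`_l != 0. Proof. exact: nz_top sizet. Qed.

Let coef_rel n : p * (Qx ^+ 2)`_n = (Qz ^+ 2)`_n + (Qt ^+ 3)`_n.
Proof. by rewrite -coefCM relQ coefD. Qed.

Let coef_small (P : {poly C}) m n N : size P = m.+1 -> (m * n < N)%N -> (P ^+ n)`_N = 0.
Proof.
move=> szP lt_N; apply: nth_default; apply: leq_trans lt_N.
by case: (coef_exp_top n (eq_leq szP)).
Qed.

Let coef_top (P : {poly C}) m n : size P = m.+1 -> (P ^+ n)`_(m * n) = P`_m ^+ n.
Proof. by move=> szP; case: (coef_exp_top n (eq_leq szP)). Qed.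

(** Factors of a nonzero constant are constant; as Qx is not, its exponent r is 0. *)
Let data_const (P : {poly C}) n d0 e0 : (0 < i)%N -> P`_n != 0 -> leading_data P n d0 e0 ->
  exists e w g, [/\ weighted_form w g, ev g != 0, (size (ev g) <= 1)%N,
    L1%:Z * (2 * e)%:Z = L1%:Z * d0 - u1 *+ n &
    L2%:Z * ((6 * e)%:Z + w%:Z) = L2%:Z * e0 - u2 *+ n].
Proof.
move=> i0 nzP [e [r [w [g [wg lcE eq1 eq2]]]]].
have : (- p)%:P ^+ e * Qx ^+ r * ev g != 0 by rewrite -lcE polyC_eq0.
rewrite mulf_eq0 negb_or => /andP[nz1 nz2].
have : size ((- p)%:P ^+ e * Qx ^+ r * ev g) = 1%N by rewrite -lcE size_polyC nzP.
have nzQx : Qx != 0 by rewrite -size_poly_gt0 sizex.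
rewrite size_mul // -polyC_exp mul_polyC size_scale ?expf_neq0 ?oppr_eq0 //.
case/predn_add_eq1; rewrite ?size_poly_gt0 ?expf_neq0 // => size_Qx size_ev.
have r0 : r = 0%N.
  have /eqP := size_exp Qx r; rewrite size_Qx sizex /= eq_sym muln_eq0.
  by rewrite -[i == _]negbK -lt0n i0 => /eqP.
by exists e, w, g; rewrite size_ev; split=> //; rewrite -eq1 r0 subr0.
Qed.

(* When Qx is not constant, leading forms of invariants have even x-degree. *)
Let neq_ij : (0 < i)%N -> i <> j.
Proof.
move=> i0 eq_ij.
have [e [_ [_ [_ _ _ eqx _]]]] := data_const i0 nzX datax.
have [e' [_ [_ [_ _ _ eqz _]]]] := data_const i0 nzZ dataz.
by rewrite eq_ij in eqx; apply: parity_absurd eqx eqz.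
Qed.

Let weights_absurd : (0 < i)%N ->
  (forall w g, weighted_form w g -> ev g != 0 -> (size (ev g) <= 1)%N -> w = 0%N) -> False.
Proof.
move=> i0 w0; apply: (neq_ij i0).
have [e [w [g [wg nz sz eq1 eq2]]]] := data_const i0 nzX datax.
have [e' [w' [g' [wg' nz' sz' eq1' eq2']]]] := data_const i0 nzZ dataz.
rewrite (w0 _ _ wg nz sz) in eq2; rewrite (w0 _ _ wg' nz' sz') in eq2'.
exact: weights_determine eq1 eq2 eq1' eq2'.
Qed.

(** The terms of [relQ] have U-degrees 2i, 2j and 3l, and the largest of these cannot be attained by
    one term alone. *)
Lemma leading_forms_const :
  [/\ (size Qx <= 1)%N, (size Qz <= 1)%N & (size Qt <= 1)%N].
Proof.
rewrite sizex sizez sizet.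
have [i0|i0] := posnP i.
  have Qx1 : Qx = 1 by rewrite [Qx]size1_polyC ?Qx0 // sizex i0.
  have x_small N : (0 < N)%N -> (Qx ^+ 2)`_N = 0.
    by move=> N0; apply: (coef_small sizex); rewrite i0.
  have [lt_jl|gt_jl|eq_jl] := ltngtP (j * 2) (l * 3).
  - have := coef_rel (l * 3); rewrite x_small ?(leq_ltn_trans _ lt_jl) // mulr0.
    rewrite (coef_small sizez) // (coef_top _ sizet) add0r => /esym/eqP.
    by rewrite expf_eq0 (negPf nzT).
  - have := coef_rel (j * 2); rewrite x_small ?(leq_ltn_trans _ gt_jl) // mulr0.
    rewrite (coef_small sizet) // (coef_top _ sizez) addr0 => /esym/eqP.
    by rewrite expf_eq0 (negPf nzZ).
  have [j0|j0] := posnP j.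
    by move: eq_jl; rewrite i0 j0; case: (l).
  suff : False by [].
  (* With Qx = 1 the relation reads Qz^2 = p + (- Qt)^3. *)
  apply: (@cusp_solution_absurd 1 p Qz (- Qt)).
  - rewrite mul1r [(- Qt) ^+ 3]exprNn -[in LHS](addrK (Qt ^+ 3) (Qz ^+ 2)) -relQ Qx1; ring.
  - by rewrite size_polyN sizet sizez ltnS; apply: lt_of_ratio eq_jl j0.
  - by right; rewrite coefN Qt0.
  - by right.
suff : False by [].
have neq := neq_ij i0.
have pX : p * Qx`_i ^+ 2 != 0 by rewrite mulf_neq0 ?expf_neq0.
have [lt_jl|gt_jl|eq_jl] := ltngtP (j * 2) (l * 3).
- have [lt_il|gt_il|eq_il] := ltngtP (i * 2) (l * 3).
  + have := coef_rel (l * 3); rewrite (coef_small sizex) // mulr0.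
    rewrite (coef_small sizez) // (coef_top _ sizet) add0r => /esym/eqP.
    by rewrite expf_eq0 (negPf nzT).
  + have := coef_rel (i * 2); rewrite (coef_top _ sizex).
    rewrite (coef_small sizez) ?(ltn_trans lt_jl) // (coef_small sizet) // addr0.
    by move/eqP; rewrite (negPf pX).
  have [j0|j0] := posnP j.
    (* With Qz = z the relation reads p Qx^2 = z^2 + Qt^3. *)
    apply: (@cusp_solution_absurd p (z ^+ 2) Qx Qt); [|rewrite sizet sizex ltnS; exact: lt_of_ratio eq_il i0|by left|by left].
    by rewrite relQ [Qz]size1_polyC ?sizez ?j0 // Qz0 -polyC_exp.
  apply: weights_absurd => // w g wg nz sz.
  have nzg : g != 0 by apply: contraNneq nz => ->; rewrite rmorph0.
  exact: (@weighted_form_const_lt k C (@kC k : {rmorphism k -> C}) Qz Qt j l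
    (eq_leq sizez) (eq_leq sizet) w g wg nzg nzZ nzT j0 lt_jl sz).
(* Here 3l < 2j and i differs from j, so a single term has the largest U-degree. *)
- have [lt_ij|gt_ij|eq_ij] := ltngtP (i * 2) (j * 2); last by case: neq; apply/eqP; rewrite -(eqn_pmul2r (isT : (0 < 2)%N)) eq_ij.
    have := coef_rel (j * 2); rewrite (coef_small sizex) // mulr0.
    rewrite (coef_small sizet) // (coef_top _ sizez) addr0 => /esym/eqP.
    by rewrite expf_eq0 (negPf nzZ).
  have := coef_rel (i * 2); rewrite (coef_top _ sizex).
  rewrite (coef_small sizez) // (coef_small sizet) ?(ltn_trans gt_jl) // addr0.
  by move/eqP; rewrite (negPf pX).
have [lt_ij|gt_ij|eq_ij] := ltngtP (i * 2) (j * 2); last by case: neq; apply/eqP; rewrite -(eqn_pmul2r (isT : (0 < 2)%N)) eq_ij.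
  apply: weights_absurd => // w g wg nz sz.
  have nzg : g != 0 by apply: contraNneq nz => ->; rewrite rmorph0.
  have j0 : (0 < j)%N by case: (j) lt_ij.
  (* The U-degree of Qx^2 is smaller, so the top coefficients of Qz^2 and Qt^3 cancel. *)
  have eqZT : Qz`_j ^+ 2 + Qt`_l ^+ 3 = 0.
    rewrite -(coef_top _ sizez) -(coef_top _ sizet) -eq_jl -coef_rel.
    by rewrite (coef_small sizex) // mulr0.
  have gt1 : (1 < size (Qz ^+ 2 + Qt ^+ 3)%R)%N.
    rewrite -relQ mul_polyC size_scale //.
    exact: size_gt1_exp sizex i0 _.
  exact: (@weighted_form_const_eq k C (@kC k : {rmorphism k -> C}) Qz Qt j l
    (eq_leq sizez) (eq_leq sizet) w g wg nzg nzZ nzT j0 eq_jl eqZT nz sz gt1).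
have := coef_rel (i * 2); rewrite (coef_top _ sizex).
rewrite (coef_small sizez) // (coef_small sizet) -?eq_jl // addr0.
by move/eqP; rewrite (negPf pX).
Qed.
End Core.
End LeadingForms.

(** * Leading parts of an exponential map *)

(** Positive powers of x lie strictly below degree 0. This is how eta is replaced by its constant
    coefficient. *)
Lemma top_ev1_neg (G : zmodType) pos (A R S : comNzRingType) (T : G -> R -> S -> Prop)
    (f : {rmorphism A -> R}) (f' : {rmorphism A -> S}) d x x' (p : {poly A}) :
  top_rel pos T -> (forall a, T 0 (f a) (f' a)) -> T d x x' ->
  (forall i, (0 < i)%N -> pos (- (d *+ i))) -> T 0 (ev1 f x p) (f' p`_0).
Proof.
move=> hT hf hx hpos; rewrite (ev1E _ _ (leqnSn _)).
have -> : f' p`_0 = \sum_(i < (size p).+1) (if i == 0 :> nat then f' p`_0 else 0).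
  by rewrite big_ord_recl /= big1 ?addr0.
apply: (top_sum hT) => i _; have hi := topM hT (hf p`_i) (topX hT i hx).
have [i0|i0] := posnP i.
  by move: hi; rewrite i0 /= mulr0n addr0 !expr0 !mulr1.
by apply: (top_lower hT hi); rewrite !add0r; exact: hpos.
Qed.

(** * Weighted components and the construction of both gradings *)

Section WeightComponent.
Variable k : fieldType.
Local Notation C := {poly {poly k}}.

Definition weight_component (w : nat) (g : C) : C :=
  \poly_(c < size g) \poly_(b < size g`_c)
    (if (3 * b + 2 * c == w)%N then g`_c`_b else 0).

Lemma coef_weight_component w g c b : (weight_component w g)`_c`_b =
  if (3 * b + 2 * c == w)%N then g`_c`_b else 0.
Proof.
rewrite coef_poly; case: ltnP => [_|le_c].
  rewrite coef_poly; case: ltnP => // le_b.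
  by rewrite [RHS in _ = if _ then RHS else _]nth_default // if_same.
by rewrite coef0 [g`_c]nth_default // coef0 if_same.
Qed.

Lemma weight_component_form w g : weighted_form w (weight_component w g).
Proof. by move=> b c; rewrite coef_weight_component; case: (_ =P w) => //; rewrite eqxx. Qed.

Definition weight_le (w : nat) (g : C) : Prop :=
  forall b c, g`_c`_b != 0 -> (3 * b + 2 * c <= w)%N.

Lemma weight_exists (g : C) : g != 0 ->
  exists w, weight_le w g /\ weight_component w g != 0.
Proof.
move=> nzg; have [n [le_gn le_gcn]] := bidegree_bound g.
pose P w := [exists b : 'I_n, exists c : 'I_n, (g`_c`_b != 0) && (3 * b + 2 * c == w)%N].
have PP b c : g`_c`_b != 0 -> P (3 * b + 2 * c)%N.
  move=> nz; have lt_c : (c < n)%N.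
    by apply: contraNT nz; rewrite -leqNgt => le_c;
      rewrite [g`_c]nth_default ?coef0 // (leq_trans le_gn).
  have lt_b : (b < n)%N.
    by apply: contraNT nz; rewrite -leqNgt => le_b; rewrite nth_default // (leq_trans (le_gcn c)).
  by apply/existsP; exists (Ordinal lt_b); apply/existsP; exists (Ordinal lt_c); rewrite nz /=.
have exP : exists w, P w.
  have nzc : g`_(size g).-1 != 0 by rewrite -lead_coefE lead_coef_eq0.
  exists (3 * (size (g`_(size g).-1)%R).-1 + 2 * (size g).-1)%N; apply: PP.
  by rewrite -lead_coefE lead_coef_eq0.
have leP w : P w -> (w <= 5 * n)%N.
  by case/existsP=> b /existsP[c /andP[_ /eqP <-]]; have := ltn_ord b; have := ltn_ord c; lia.
case: (ex_maxnP exP leP) => w /existsP[b /existsP[c /andP[nz /eqP eqw]]] maxw.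
exists w; split=> [b' c' /PP|]; first exact: maxw.
apply: contra nz => /eqP/(congr1 (fun q : C => q`_c`_b)).
by rewrite coef_weight_component eqw eqxx !coef0 => ->.
Qed.

Lemma top_weight (G : zmodType) pos (R S : comNzRingType) (T : G -> R -> S -> Prop)
    (f : {rmorphism k -> R}) (f' : {rmorphism k -> S}) d z t z' t' w g :
  top_rel pos T -> (forall a, T 0 (f a) (f' a)) -> T (d *+ 3) z z' -> T (d *+ 2) t t' ->
  (forall i, (0 < i)%N -> pos (d *+ i)) -> weight_le w g ->
  T (d *+ w) (ev2 f z t g) (ev2 f' z' t' (weight_component w g)).
Proof.
move=> hT hf hz ht hpos le_w; have [n [le_gn le_gcn]] := bidegree_bound g.
have le_cn : (size (weight_component w g) <= n)%N := leq_trans (size_poly _ _) le_gn.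
have le_ccn c : (size ((weight_component w g)`_c)%R <= n)%N.
  rewrite coef_poly; case: ltnP => _; last by rewrite size_poly0.
  exact: leq_trans (size_poly _ _) (le_gcn c).
rewrite (ev2E _ _ _ le_gn le_gcn) (ev2E _ _ _ le_cn le_ccn).
apply: (top_sum hT) => c _; apply: (top_sum hT) => b _; rewrite coef_weight_component.
have [->|nz] := eqVneq g`_c`_b 0; first by rewrite if_same !rmorph0 !mul0r; exact: top0 hT _.
have hm := topM hT (topM hT (hf g`_c`_b) (topX hT b hz)) (topX hT c ht).
have eq_d : 0 + d *+ 3 *+ b + d *+ 2 *+ c = d *+ (3 * b + 2 * c).
  by rewrite add0r mulrnDr !mulrnA.
rewrite eq_d in hm; case: eqP => [<- //|ne_w]; rewrite rmorph0 !mul0r.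
apply: (top_lower hT hm); rewrite -mulrnBr ?le_w //; apply: hpos.
by rewrite subn_gt0 ltn_neqAle le_w // andbT; apply/eqP.
Qed.
End WeightComponent.

Section TopExistence.
Variables (k : fieldType) (D : idomainType) (f : {rmorphism k -> D}).
Local Notation F := {fraction {poly D}}.

Let kF : {rmorphism k -> F} := @tofrac _ \o (polyC \o f).

Let nzX : tofrac 'X != 0 :> F.
Proof. by rewrite tofrac_eq0 polyX_eq0. Qed.

Let hLT : top_rel int_pos (@laurent_top D) := laurent_topP D.

Let top_const (g : D) : laurent_top 0 (tofrac g%:P) g.
Proof. by have := laurent_top_poly g%:P; rewrite coefC. Qed.

Let laurent_topVXM L n : laurent_top (L%:Z *+ n) (tofrac 'X ^- (L * n) : F) 1.
Proof. by have := @laurent_topVX D (L * n); rewrite PoszM -[L%:Z *+ n]mulr_natr natz. Qed.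

(** The weight becomes an order of pole under z -> z X^(-3L), t -> t X^(-2L). *)
Lemma weight_top_exists L (z t : D) : exists T : int -> {poly {poly k}} -> D -> Prop,
  [/\ top_rel int_pos T, T (L%:Z *+ 3) 'X%:P z, T (L%:Z *+ 2) 'X t &
    forall a, T 0 a%:P%:P (f a)].
Proof.
pose sub : {rmorphism {poly {poly k}} -> F} :=
  ev2 kF (tofrac z%:P * tofrac 'X ^- (L * 3)) (tofrac t%:P * tofrac 'X ^- (L * 2)).
exists (fun d g h => laurent_top d (sub g) h); split.
- exact: (@top_comp _ _ _ _ _ hLT {poly {poly k}} sub).
- rewrite /sub /= ev2z -[_ *+ 3]add0r -[X in laurent_top _ _ X]mulr1.
  by apply: (topM hLT); [exact: top_const | exact: laurent_topVXM].
- rewrite /sub /= ev2t -[_ *+ 2]add0r -[X in laurent_top _ _ X]mulr1.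
  by apply: (topM hLT); [exact: top_const | exact: laurent_topVXM].
- by move=> a; rewrite /sub /= ev2C; exact: top_const.
Qed.

(** Sending x to X^L and solving the relation for y makes the x-degree an order of pole at X = 0,
    scaled by L. *)
Lemma pole_top_exists L (R : comAlgType k) (x y z t : R) (eta : {poly k}) (z0 t0 : D) :
  presentation x y z t eta -> (0 < L)%N -> exists T : int -> R -> D -> Prop,
  [/\ top_rel int_pos T, T (- L%:Z) x 1,
    T (L%:Z *+ 2) y (- (z0 ^+ 2 + t0 ^+ 3 + f eta`_0)) &
    [/\ T 0 z z0, T 0 t t0 & forall a, T 0 a%:A (f a)]].
Proof.
move=> presR L0; pose x' : F := tofrac 'X ^+ L.
pose z' : F := tofrac z0%:P; pose t' : F := tofrac t0%:P.
pose W := z' ^+ 2 + t' ^+ 3 + ev1 kF x' eta.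
have nzx' : x' != 0 by rewrite expf_neq0.
have hx : laurent_top (- L%:Z) x' 1 by exact: laurent_topX.
have hz : laurent_top 0 z' z0 by exact: top_const.
have ht : laurent_top 0 t' t0 by exact: top_const.
have [|g [gx gy gz gt gk]] := pres_lift presR (f := kF) (x' := x') (y' := - W * x' ^- 2)
    (z' := z') (t' := t').
  have mulK (K : fieldType) (a b : K) : a != 0 -> a ^+ 2 * (b * a ^- 2) = b.
    by move=> nza; rewrite mulrC mulfVK ?expf_neq0.
  rewrite (mulK _ _ _ nzx').
  have add3 (V : zmodType) (a b c : V) : - (a + b + c) + a + b + c = 0.
    by rewrite -!addrA addNr.
  exact: add3.
exists (fun d a c => laurent_top d (g a) c); split.
- exact: (@top_comp _ _ _ _ _ hLT R g).
- by rewrite gx.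
- rewrite gy -[_ *+ 2]add0r -[X in laurent_top _ _ X]mulr1; apply: (topM hLT).
    apply: (topN hLT); apply: (topD hLT); first apply: (topD hLT).
    + by rewrite -(mul0rn _ 2); apply: (topX hLT).
    + by rewrite -(mul0rn _ 3); apply: (topX hLT).
    apply: (top_ev1_neg eta hLT _ hx) => [a|i i0]; first exact: top_const.
    by rewrite /int_pos mulNrn opprK pmulrn_lgt0.
  by rewrite /x' -exprM; exact: laurent_topVXM.
by split=> [||a]; rewrite ?gz ?gt ?gk //; exact: top_const.
Qed.
End TopExistence.

(** * First stage: the x-degree *)

Section Stages.
Variables (k : fieldType) (R : comAlgType k) (x y z t : R) (eta : {poly k}).
Hypothesis presR : presentation x y z t eta.
Variable phi : {rmorphism R -> {poly R}}.
Hypothesis hphi : exponential_map phi.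
Local Notation C := {poly {poly k}}.
Local Notation emb := (embed_zt z t : {rmorphism C -> R}).
Local Notation fC := (polyC \o @kC k).
Local Notation pc := ('X%:P ^+ 2 + 'X ^+ 3 + kC eta`_0 : C).

Lemma pres_equation : x ^+ 2 * y + z ^+ 2 + t ^+ 3 + ev1 (in_alg R) x eta = 0.
Proof.
rewrite (pres_rel presR) /zt_part rmorphD /= embed_xztC rmorphD !rmorphXn /=.
rewrite embed_zt_z embed_zt_t.
suff -> : embed_xzt x z t (map_poly (@kC k) eta) = ev1 (in_alg R) x eta.
  by rewrite -addrA -addrA [X in _ + X]addrA addNr.
rewrite map_poly_ev1 (rmorph_ev1 (polyC \o @kC k) 'X (embed_xzt x z t) eta).
rewrite -[LHS]/(ev1 _ (embed_xzt x z t 'X) eta) embed_xztX.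
by apply: eq_ev1 => a; rewrite [LHS]embed_xztC [LHS]embed_zt_alg.
Qed.

Lemma phi0 a : (phi a)`_0 = a.
Proof. by rewrite -horner_coef0; exact: exponential_map_eval0. Qed.

Lemma phi_alg a : phi a%:A = (a%:A)%:P.
Proof. exact: exponential_map_alg. Qed.

Lemma phi_size1 a : (size (phi a) <= 1)%N -> phi a = a%:P.
Proof. by move/size1_polyC->; rewrite phi0. Qed.

Lemma phi_moves_generator : (exists a, phi a <> a%:P) ->
  [\/ (1 < size (phi x))%N, (1 < size (phi y))%N, (1 < size (phi z))%N | (1 < size (phi t))%N].
Proof.
case=> a nfix; apply/or4P; apply: contra_notT nfix; rewrite !negb_or -!leqNgt.
case/and4P=> /phi_size1 fx /phi_size1 fy /phi_size1 fz /phi_size1 ft.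
have [h <-] := pres_surj presR a.
rewrite [LHS](rmorph_ev1 _ _ phi) [RHS](rmorph_ev1 _ _ (@polyC R)).
rewrite -[phi y]/(phi y) fy; apply: eq_ev1 => q /=.
rewrite [LHS](rmorph_ev1 _ _ phi) [RHS](rmorph_ev1 _ _ (@polyC R)) fx.
apply: eq_ev1 => g /=.
rewrite [LHS](rmorph_ev1 _ _ phi) [RHS](rmorph_ev1 _ _ (@polyC R)) ft.
apply: eq_ev1 => b /=.
rewrite [LHS](rmorph_ev1 _ _ phi) [RHS](rmorph_ev1 _ _ (@polyC R)) fz.
by apply: eq_ev1 => c /=; exact: phi_alg.
Qed.

Definition pole_top (L : nat) (T : int -> R -> C -> Prop) : Prop :=
  [/\ top_rel int_pos T, T (- L%:Z) x 1, T (L%:Z *+ 2) y (- pc) &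
    [/\ T 0 z 'X%:P, T 0 t 'X & forall a, T 0 a%:A (kC a)]].

Lemma pole_top_leading L T e r g a : (0 < L)%N -> pole_top L T ->
  x_leading emb x y e r g a -> T (L%:Z * ((2 * e)%:Z - r%:Z)) a ((- pc) ^+ e * g).
Proof.
move=> L0 [hT Tx Ty [Tz Tt Tk]] ha.
pose psi : {rmorphism C -> C} := @ev2 k C (@kC k) 'X%:P 'X.
have Tg h : T 0 (emb h) (psi h).
  exact: (@top_ev2 _ _ k R C T (in_alg R) (@kC k) z t 'X%:P 'X hT Tk Tz Tt h).
have := top_leading hT L0 Tx Ty Tg ha.
by rewrite expr1n mulr1 /psi /= ev2_id.
Qed.

Lemma pc_neq0 : pc != 0.
Proof.
apply/eqP => /(congr1 (fun q : C => q`_3)).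
rewrite !coefD coefXn -polyC_exp !coefC /= add0r addr0.
by move/eqP; rewrite oner_eq0.
Qed.

Lemma leading_form a : (exists q, a = embed_xzt x z t q) \/
  exists e r g, [/\ (0 < e)%N, (r <= 1)%N & x_leading emb x y e r g a].
Proof. exact: leading_exists (pres_surj presR) (pres_rel presR). Qed.

Lemma leading_form_neq0 a : a != 0 -> exists e r g, x_leading emb x y e r g a.
Proof.
move=> nza; have [[q aE]|[e [r [g [_ _ ha]]]]] := leading_form a; last by exists e, r, g.
have nzq : q != 0 by apply: contraNneq nza => q0; rewrite aE q0 rmorph0.
have [r [hr _]] := x_leading_poly emb x y nzq.
by exists 0%N, r, q`_r; rewrite aE.
Qed.

Lemma stage1 : (exists a, phi a <> a%:P) -> exists L u T (Px Py Pz Pt : {poly C}),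
  [/\ (0 < L)%N /\ pole_top L T,
    poly_top T u (- L%:Z) (phi x) Px /\ poly_top T u (L%:Z *+ 2) (phi y) Py,
    poly_top T u 0 (phi z) Pz /\ poly_top T u 0 (phi t) Pt &
    [\/ (1 < size Px)%N, (1 < size Py)%N, (1 < size Pz)%N | (1 < size Pt)%N]].
Proof.
move=> /phi_moves_generator moves.
(* The scale L is an output of [slope_exists], so a grading is fixed for every L beforehand; L = 0
   gets a dummy relation. *)
have /choice[T hT] : forall L, exists T, (0 < L)%N -> pole_top L T.
  move=> L; have [->|L0] := posnP L; first by exists (fun _ _ _ => False).
  by have [T hT] := @pole_top_exists k C (@kC k) L R x y z t eta 'X%:P 'X presR L0; exists T.
have topT L : (0 < L)%N -> top_rel int_pos (T L) by case/hT.
have degree a : a != 0 -> exists d, forall L, (0 < L)%N ->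
    exists2 c, c != 0 & T L (L%:Z * d) a c.
  case/leading_form_neq0=> e [r [g ha]]; exists ((2 * e)%:Z - r%:Z) => L L0.
  exists ((- pc) ^+ e * g); last exact: pole_top_leading L0 (hT _ L0) ha.
  by rewrite mulf_neq0 ?expf_neq0 ?oppr_eq0 ?pc_neq0 //; case: ha.
pose s := [:: (phi x, - 1); (phi y, 2); (phi z, 0); (phi t, 0 : int)].
have [||L [u [L0 hs [p [P [ps gt1 hP]]]]]] := @slope_exists R C T topT degree s.
- move=> p; rewrite !inE => /or4P[] /eqP -> L L0 /=; rewrite phi0;
    have [_ Tx Ty [Tz Tt _]] := hT L L0.
  + by exists 1; rewrite mulrN1.
  + by exists (- pc); rewrite mulr_natr.
  + by exists 'X%:P; rewrite mulr0.
  + by exists 'X; rewrite mulr0.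
- case: moves => lt1; [exists (phi x, - 1)|exists (phi y, 2)|exists (phi z, 0)|exists (phi t, 0)];
    by rewrite // !inE eqxx ?orbT.
have [|Px hPx] := hs (phi x, - 1); first by rewrite !inE eqxx.
have [|Py hPy] := hs (phi y, 2); first by rewrite !inE eqxx ?orbT.
have [|Pz hPz] := hs (phi z, 0); first by rewrite !inE eqxx ?orbT.
have [|Pt hPt] := hs (phi t, 0); first by rewrite !inE eqxx ?orbT.
rewrite /= mulrN1 in hPx; rewrite /= mulr_natr in hPy; rewrite /= mulr0 in hPz hPt.
exists L, u, (T L), Px, Py, Pz, Pt; split=> //; first by split=> //; exact: hT.
(* Uniqueness of leading parts identifies the nonconstant P with one of Px, Py, Pz, Pt. *)
have uniq := top_uniq (top_poly (topT L L0) u).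
move: ps hP; rewrite !inE => /or4P[] /eqP -> /= hP.
- by apply: Or41; rewrite mulrN1 in hP; rewrite (uniq _ _ _ _ hPx hP).
- by apply: Or42; rewrite mulr_natr in hP; rewrite (uniq _ _ _ _ hPy hP).
- by apply: Or43; rewrite mulr0 in hP; rewrite (uniq _ _ _ _ hPz hP).
- by apply: Or44; rewrite mulr0 in hP; rewrite (uniq _ _ _ _ hPt hP).
Qed.
End Stages.

Lemma mulrn_pair (G H : zmodType) (d : G) (e : H) n : (d, e) *+ n = (d *+ n, e *+ n).
Proof. by elim: n => // n IHn; rewrite !mulrSr IHn. Qed.

Lemma lex_posN (d : int * int) : d != 0 -> lex_pos d \/ lex_pos (- d).
Proof.
case: d => a b; rewrite /lex_pos /= => nz.
have [a0|a0|a0] := ltrgtP 0 a; [by left; left| by right; left; lia|].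
have nzb : b != 0 by apply: contraNneq nz => ->; rewrite -a0.
by have [b0|b0|b0] := ltrgtP 0 b; [left; right|right; right; lia|rewrite b0 eqxx in nzb].
Qed.

Lemma lex_index_uniq (A C : comNzRingType) (T : int * int -> A -> C -> Prop) d d' a c c' :
  top_rel lex_pos T -> T d a c -> T d' a c' -> c != 0 -> c' != 0 -> d = d'.
Proof.
move=> hT h h' nz nz'; apply/eqP; rewrite -subr_eq0; apply/negPn/negP => /lex_posN[pos|pos].
  by move: nz; rewrite (top_uniq hT h (top_lower hT h' pos)) eqxx.
by rewrite opprB in pos; move: nz'; rewrite (top_uniq hT h' (top_lower hT h pos)) eqxx.
Qed.

Lemma poly_top_const (G : zmodType) pos (A C : comNzRingType) (T : G -> A -> C -> Prop) u d a c :
  top_rel pos T -> T d a c -> poly_top T u d a%:P c%:P.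
Proof.
move=> hT h n; rewrite !coefC; case: eqP => [->|_]; last exact: top0 hT _.
by rewrite mulr0n subr0.
Qed.

Section Lex.
Variables (A B C : comNzRingType) (T : int -> A -> B -> Prop) (S : int -> B -> C -> Prop).

Lemma poly_top_lex u v d e (P : {poly A}) (Q : {poly B}) (W : {poly C}) :
  poly_top T u d P Q -> poly_top S v e Q W -> poly_top (lex_top T S) (u, v) (d, e) P W.
Proof. by move=> h h' n; exists Q`_n; rewrite mulrn_pair; [exact: h | exact: h']. Qed.
End Lex.

(* The iterative property makes the leading coefficient D_n(a) of phi(a)
   invariant; here this is transported to leading forms. *)
Lemma poly_top_iterate (k : fieldType) (R : comAlgType k) (phi : {rmorphism R -> {poly R}})
    (G : zmodType) pos (C : comNzRingType) (T : G -> R -> C -> Prop) u d a (Q : {poly C}) n :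
  exponential_map phi -> top_rel pos T -> poly_top T u d (phi a) Q -> (size Q <= n.+1)%N ->
  poly_top T u (d - u *+ n) (phi (phi a)`_n) (Q`_n)%:P.
Proof.
move=> hphi hT h szQ m; rewrite (exponential_map_iterative hphi) -addrA -opprD -mulrnDr addnC.
have -> : ((Q`_n)%:P)`_m = Q`_(m + n) *+ 'C(m + n, m).
  rewrite coefC; case: m => [|m] /=; first by rewrite bin0 add0n.
  by rewrite nth_default ?mul0rn // (leq_trans szQ) // addSn ltnS leq_addl.
by apply: (topMn hT); exact: h.
Qed.

Section Stage1Theory.
Variables (k : fieldType) (R : comAlgType k) (x y z t : R) (eta : {poly k}).
Hypothesis presR : presentation x y z t eta.
Variable phi : {rmorphism R -> {poly R}}.
Hypothesis hphi : exponential_map phi.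
Local Notation C := {poly {poly k}}.
Local Notation emb := (embed_zt z t : {rmorphism C -> R}).
Local Notation pc := ('X%:P ^+ 2 + 'X ^+ 3 + kC eta`_0 : C).
Variables (L : nat) (u : int) (T : int -> R -> C -> Prop) (Px Py Pz Pt : {poly C}).
Hypotheses (L_gt0 : (0 < L)%N) (hT : pole_top x y z t eta L T).
Hypotheses (hPx : poly_top T u (- L%:Z) (phi x) Px)
  (hPy : poly_top T u (L%:Z *+ 2) (phi y) Py)
  (hPz : poly_top T u 0 (phi z) Pz) (hPt : poly_top T u 0 (phi t) Pt).

Definition stage1_subst : {rmorphism C -> {poly C}} :=
  @ev2 k {poly C} (polyC \o @kC k) Pz Pt.

Let topT : top_rel int_pos T. Proof. by case: hT. Qed.

Let topP : top_rel int_pos (poly_top T u). Proof. exact: top_poly topT u. Qed.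

Let topR : top_rel int_pos (fun d a P => poly_top T u d (phi a) P).
Proof. exact: (@top_comp _ _ _ _ _ topP R phi). Qed.

Lemma stage1_alg a : poly_top T u 0 (phi a%:A) (kC a)%:P.
Proof.
rewrite (phi_alg hphi); apply: (poly_top_const _ topT).
by case: hT => _ _ _ [_ _]; apply.
Qed.

Lemma stage1_zt g : poly_top T u 0 (phi (emb g)) (stage1_subst g).
Proof.
exact: (@top_ev2 _ _ k R {poly C} _ (in_alg R) (polyC \o @kC k) z t Pz Pt
  topR stage1_alg hPz hPt g).
Qed.

Lemma stage1_leading e r g a : x_leading emb x y e r g a ->
  poly_top T u (L%:Z * ((2 * e)%:Z - r%:Z)) (phi a) (Py ^+ e * Px ^+ r * stage1_subst g).
Proof.
exact: (@top_leading C R emb x y {poly C} _ topR L stage1_subst Px Py L_gt0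
  hPx hPy stage1_zt e r g a).
Qed.

Lemma stage1_filtration d a : x_filtration emb x y d a ->
  exists P, poly_top T u (L%:Z * d) (phi a) P.
Proof.
exact: (@top_filtration C R emb x y {poly C} _ topR L stage1_subst Px Py L_gt0
  hPx hPy stage1_zt d a).
Qed.

Lemma stage1_coef0 d a P c : poly_top T u d (phi a) P -> T d a c -> P`_0 = c.
Proof. by move=> /(_ 0%N); rewrite (phi0 hphi) mulr0n subr0 => h0 h; exact: (top_uniq topT h0 h). Qed.

Lemma stage1_relation : Px ^+ 2 * Py + Pz ^+ 2 + Pt ^+ 3 + (kC eta`_0)%:P = 0.
Proof.
have h1 : poly_top T u 0 (phi (ev1 (in_alg R) x eta)) (kC eta`_0)%:P.
  apply: (@top_ev1_neg _ _ k R {poly C} _ (in_alg R) (polyC \o @kC k) _ x Px eta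
    topR stage1_alg hPx) => i i0.
  by rewrite /int_pos mulNrn opprK pmulrn_lgt0.
have h2 : poly_top T u 0 (phi (x ^+ 2 * y)) (Px ^+ 2 * Py).
  have := topM topR (topX topR 2 hPx) hPy.
  by rewrite mulNrn addNr.
have h3 : poly_top T u 0 (phi (z ^+ 2)) (Pz ^+ 2).
  by rewrite -(mul0rn _ 2); exact: (topX topR 2 hPz).
have h4 : poly_top T u 0 (phi (t ^+ 3)) (Pt ^+ 3).
  by rewrite -(mul0rn _ 3); exact: (topX topR 3 hPt).
have := topD topR (topD topR (topD topR h2 h3) h4) h1.
by rewrite (pres_equation presR) => /(top0_eq0 topR).
Qed.
End Stage1Theory.

(** * Second stage: the weights of z and t *)

Section Stage2.
Variable k : fieldType.
Local Notation C := {poly {poly k}}.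
Local Notation p0 := ('X%:P ^+ 2 + 'X ^+ 3 : C).

Definition weight_top (L : nat) (S : int -> C -> C -> Prop) : Prop :=
  [/\ top_rel int_pos S, S (L%:Z *+ 3) 'X%:P 'X%:P, S (L%:Z *+ 2) 'X 'X &
    forall a, S 0 (kC a) (kC a)].

Lemma weight_top_component L S w g : (0 < L)%N -> weight_top L S -> weight_le w g ->
  S (L%:Z *+ w) g (weight_component w g).
Proof.
move=> L0 [hS Sz St Sk] le_w.
have := @top_weight k _ _ C C S (@kC k) (@kC k) L%:Z 'X%:P 'X 'X%:P 'X w g hS Sk Sz St
  _ le_w.
rewrite [ev2 _ _ _ g]ev2_id [ev2 _ _ _ (weight_component w g)]ev2_id; apply=> i i0.
by rewrite /int_pos pmulrn_lgt0.
Qed.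

Lemma weight_top_cusp L S c : (0 < L)%N -> weight_top L S -> S (L%:Z *+ 6) (- (p0 + kC c)) (- p0).
Proof.
move=> L0 [hS Sz St Sk]; apply: (topN hS); rewrite -[X in S _ _ X]addr0.
apply: (topD hS); last by apply: (top_lower hS (Sk c)); rewrite /int_pos subr0 pmulrn_lgt0.
apply: (topD hS); first by rewrite (mulrnA _ 3 2); exact: (topX hS 2 Sz).
by rewrite (mulrnA _ 2 3); exact: (topX hS 3 St).
Qed.

Lemma stage2 (c : k) (Px Py Pz Pt : {poly C}) :
  Px`_0 = 1 -> Py`_0 = - (p0 + kC c) -> Pz`_0 = 'X%:P -> Pt`_0 = 'X ->
  [\/ (1 < size Px)%N, (1 < size Py)%N, (1 < size Pz)%N | (1 < size Pt)%N] ->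
  exists L v S (Qx Qy Qz Qt : {poly C}),
  [/\ (0 < L)%N /\ weight_top L S,
    poly_top S v 0 Px Qx /\ poly_top S v (L%:Z *+ 6) Py Qy,
    poly_top S v (L%:Z *+ 3) Pz Qz /\ poly_top S v (L%:Z *+ 2) Pt Qt &
    [\/ (1 < size Qx)%N, (1 < size Qy)%N, (1 < size Qz)%N | (1 < size Qt)%N]].
Proof.
move=> Px0 Py0 Pz0 Pt0 moves.
have /choice[S hS] : forall L, exists S, weight_top L S.
  by move=> L; have [S hS] := @weight_top_exists k C (@kC k) L 'X%:P 'X; exists S.
have topS L : (0 < L)%N -> top_rel int_pos (S L) by move=> _; case: (hS L).
have degree g : g != 0 -> exists d, forall L, (0 < L)%N ->
    exists2 c, c != 0 & S L (L%:Z * d) g c.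
  case/weight_exists=> w [le_w nz]; exists w%:Z => L L0; exists (weight_component w g) => //.
  by have := weight_top_component L0 (hS L) le_w; rewrite -[_ *+ w]mulr_natr natz.
have muln_int L (n : nat) : L%:Z * n%:Z = L%:Z *+ n by rewrite -[_ *+ n]mulr_natr natz.
(* After the first stage x is 1, of weight 0, and y is -(z^2 + t^3 + c), of weight at most 6. *)
pose s := [:: (Px, 0 : int); (Py, 6); (Pz, 3); (Pt, 2)].
have [||L [v [L0 hs [p [P [ps gt1 hP]]]]]] := @slope_exists C C S topS degree s.
- move=> p; rewrite !inE => /or4P[] /eqP -> L L0 /=; have [_ Sz St _] := hS L.
  + by exists 1; rewrite mulr0 Px0; exact: top1 (topS L L0).
  + by exists (- p0); rewrite Py0 (muln_int L 6%N); exact: weight_top_cusp.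
  + by exists 'X%:P; rewrite Pz0 (muln_int L 3%N).
  + by exists 'X; rewrite Pt0 (muln_int L 2%N).
- case: moves => lt1; [exists (Px, 0)|exists (Py, 6)|exists (Pz, 3)|exists (Pt, 2)];
    by rewrite // !inE eqxx ?orbT.
have [|Qx hQx] := hs (Px, 0); first by rewrite !inE eqxx.
have [|Qy hQy] := hs (Py, 6); first by rewrite !inE eqxx ?orbT.
have [|Qz hQz] := hs (Pz, 3); first by rewrite !inE eqxx ?orbT.
have [|Qt hQt] := hs (Pt, 2); first by rewrite !inE eqxx ?orbT.
rewrite /= mulr0 in hQx; rewrite /= (muln_int L 6%N) in hQy.
rewrite /= (muln_int L 3%N) in hQz; rewrite /= (muln_int L 2%N) in hQt.
exists L, v, (S L), Qx, Qy, Qz, Qt; split=> //.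
have uniq := top_uniq (top_poly (topS L L0) v).
move: ps hP; rewrite !inE => /or4P[] /eqP -> /= hP.
- by apply: Or41; rewrite mulr0 in hP; rewrite (uniq _ _ _ _ hQx hP).
- by apply: Or42; rewrite (muln_int L 6%N) in hP; rewrite (uniq _ _ _ _ hQy hP).
- by apply: Or43; rewrite (muln_int L 3%N) in hP; rewrite (uniq _ _ _ _ hQz hP).
- by apply: Or44; rewrite (muln_int L 2%N) in hP; rewrite (uniq _ _ _ _ hQt hP).
Qed.
End Stage2.

Section Stage2Theory.
Variables (k : fieldType) (R : comAlgType k) (x y z t : R) (eta : {poly k}).
Hypothesis presR : presentation x y z t eta.
Variable phi : {rmorphism R -> {poly R}}.
Hypothesis hphi : exponential_map phi.
Local Notation C := {poly {poly k}}.
Local Notation emb := (embed_zt z t : {rmorphism C -> R}).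
Local Notation pc := ('X%:P ^+ 2 + 'X ^+ 3 + kC eta`_0 : C).
Local Notation p0 := ('X%:P ^+ 2 + 'X ^+ 3 : C).
Variables (L1 : nat) (u : int) (T : int -> R -> C -> Prop) (Px Py Pz Pt : {poly C}).
Hypotheses (L1_gt0 : (0 < L1)%N) (hT : pole_top x y z t eta L1 T).
Hypotheses (hPx : poly_top T u (- L1%:Z) (phi x) Px)
  (hPy : poly_top T u (L1%:Z *+ 2) (phi y) Py)
  (hPz : poly_top T u 0 (phi z) Pz) (hPt : poly_top T u 0 (phi t) Pt).
Variables (L2 : nat) (v : int) (S : int -> C -> C -> Prop) (Qx Qy Qz Qt : {poly C}).
Hypotheses (L2_gt0 : (0 < L2)%N) (hS : weight_top L2 S).
Hypotheses (hQx : poly_top S v 0 Px Qx) (hQy : poly_top S v (L2%:Z *+ 6) Py Qy)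
  (hQz : poly_top S v (L2%:Z *+ 3) Pz Qz) (hQt : poly_top S v (L2%:Z *+ 2) Pt Qt).

Definition stage2_subst : {rmorphism C -> {poly C}} :=
  @ev2 k {poly C} (polyC \o @kC k) Qz Qt.

Let topT : top_rel int_pos T. Proof. by case: hT. Qed.
Let topS : top_rel int_pos S. Proof. by case: hS. Qed.
Let lexTS := lex_top T S.
Let topL : top_rel lex_pos lexTS. Proof. exact: top_lex topT topS. Qed.
Let relL d a Q := poly_top lexTS (u, v) d (phi a) Q.
Let topR : top_rel lex_pos relL.
Proof. exact: (@top_comp _ _ _ _ _ (top_poly topL (u, v)) R phi). Qed.

Let relL_seq d e a P Q : poly_top T u d (phi a) P -> poly_top S v e P Q -> relL (d, e) a Q.
Proof. exact: poly_top_lex. Qed.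

Let relL_lower d e a : poly_top T u d (phi a) 0 -> relL (d, e) a 0.
Proof. by move=> /relL_seq; apply=> n; rewrite !coef0; exact: top0 topS _. Qed.

Let nz_p0 : p0 != 0. Proof. exact: cusp_neq0. Qed.
Let relLx : relL (- L1%:Z, 0) x Qx. Proof. exact: relL_seq hPx hQx. Qed.
Let relLy : relL (L1%:Z *+ 2, L2%:Z *+ 6) y Qy. Proof. exact: relL_seq hPy hQy. Qed.
Let relLz : relL (0, L2%:Z *+ 3) z Qz. Proof. exact: relL_seq hPz hQz. Qed.
Let relLt : relL (0, L2%:Z *+ 2) t Qt. Proof. exact: relL_seq hPt hQt. Qed.

Let relL_alg a : relL 0 a%:A (kC a)%:P.
Proof.
apply: (relL_seq (stage1_alg hphi u hT a)); apply: (poly_top_const _ topS).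
by case: hS.
Qed.

Let relL_zt w g : weight_le w g ->
  relL (0, L2%:Z *+ w) (emb g) (stage2_subst (weight_component w g)).
Proof.
have -> : (0, L2%:Z *+ w) = (0, L2%:Z) *+ w :> (int * int)%type by rewrite mulrn_pair mul0rn.
apply: (@top_weight k _ _ R {poly C} relL (in_alg R) (polyC \o @kC k) (0, L2%:Z)
  z t Qz Qt w g topR relL_alg) => [||i i0].
- by rewrite mulrn_pair mul0rn.
- by rewrite mulrn_pair mul0rn.
- by rewrite mulrn_pair mul0rn; right; rewrite /= pmulrn_lgt0.
Qed.

Let index e r w : int * int :=
  (L1%:Z * ((2 * e)%:Z - r%:Z), L2%:Z * ((6 * e)%:Z + w%:Z)).

Let relL_leading e r g w a : x_leading emb x y e r g a -> weight_le w g ->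
  relL (index e r w) a (Qy ^+ e * Qx ^+ r * stage2_subst (weight_component w g)).
Proof.
case=> _ hfil le_w; rewrite -[a](subrK (y ^+ e * x ^+ r * emb g)) -[X in relL _ _ X]add0r.
apply: (topD topR).
  (* The remainder has smaller x-degree, so its first component is already 0 and its weight does not
     matter. *)
  have [P hP] := stage1_filtration hphi L1_gt0 hT hPx hPy hPz hPt hfil.
  apply: relL_lower; apply: (top_lower (top_poly topT u) hP).
  by rewrite /int_pos; move: L1_gt0; clear; nia.
have := topM topR (topM topR (topX topR e relLy) (topX topR r relLx)) (relL_zt le_w).
congr (relL _ _ _); rewrite !mulrn_pair !mul0rn /index.
have mulE (n : int) m : n *+ m = n * m%:Z by rewrite -mulr_natr natz.
rewrite !mulE; congr (_, _) => /=; rewrite ?PoszM; ring.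
Qed.

Hypothesis moves :
  [\/ (1 < size Qx)%N, (1 < size Qy)%N, (1 < size Qz)%N | (1 < size Qt)%N].

Let lex_coef0 d a Q c : relL d a Q -> lexTS d a c -> Q`_0 = c.
Proof. by move=> /(_ 0%N); rewrite (phi0 hphi) mulr0n subr0 => h0 h; exact: (top_uniq topL h0 h). Qed.

Let lex_leading e r g w a : x_leading emb x y e r g a -> weight_le w g ->
  lexTS (index e r w) a ((- p0) ^+ e * weight_component w g).
Proof.
move=> ha le_w; exists ((- pc) ^+ e * g); first exact: pole_top_leading L1_gt0 hT ha.
have /= -> : L2%:Z * ((6 * e)%:Z + w%:Z) = L2%:Z *+ 6 *+ e + L2%:Z *+ w.
  by rewrite -mulrnA -mulrnDr -mulr_natr natz.
apply: (topM topS); last exact: weight_top_component L2_gt0 hS le_w.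
by apply: (topX topS); exact: weight_top_cusp L2_gt0 hS.
Qed.

(** The leading part of phi(a) is computed twice: it is the constant c by hypothesis, and it is the
    image of the leading form of a by multiplicativity. Both live at the same index because c is
    nonzero. *)
Lemma invariant_leading d a c : c != 0 -> lexTS d a c -> relL d a c%:P ->
  exists e r g w, [/\ x_leading emb x y e r g a, weight_le w g,
    weight_component w g != 0, d = index e r w &
    c%:P = Qy ^+ e * Qx ^+ r * stage2_subst (weight_component w g)].
Proof.
move=> nzc hc hrel; have nza : a != 0.
  by apply: contraNneq nzc => a0; rewrite a0 in hc; rewrite (top0_eq0 topL hc).
have [e [r [g ha]]] := leading_form_neq0 presR nza.
have [w [le_w nzw]] : exists w, weight_le w g /\ weight_component w g != 0.
  by apply: weight_exists; case: ha.
have eq_d : d = index e r w.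
  apply: (lex_index_uniq topL hc (lex_leading ha le_w)) => //.
  by rewrite mulf_neq0 ?expf_neq0 ?oppr_eq0.
exists e, r, g, w; split=> //; apply: (top_uniq topR hrel).
by rewrite eq_d; exact: relL_leading.
Qed.

Let relation2 : Qx ^+ 2 * Qy + Qz ^+ 2 + Qt ^+ 3 = 0.
Proof.
have h1 : relL 0 (ev1 (in_alg R) x eta) (kC eta`_0)%:P.
  apply: (@top_ev1_neg _ _ k R {poly C} _ (in_alg R) (polyC \o @kC k) _ x Qx eta
    topR relL_alg relLx) => i i0.
  by left; rewrite mulrn_pair /= mulNrn opprK pmulrn_lgt0.
(* Read in weight 6 L2, the constant c of weight 0 contributes nothing. *)
have {}h1 : relL (0, L2%:Z *+ 6) (ev1 (in_alg R) x eta) 0.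
  by apply: (top_lower topR h1); right; rewrite subr0 /= pmulrn_lgt0.
have h2 : relL (0, L2%:Z *+ 6) (x ^+ 2 * y) (Qx ^+ 2 * Qy).
  have := topM topR (topX topR 2 relLx) relLy.
  by congr (relL _ _ _); rewrite mulrn_pair mul0rn mulNrn; congr (_, _); rewrite /= ?addNr ?add0r.
have h3 : relL (0, L2%:Z *+ 6) (z ^+ 2) (Qz ^+ 2).
  have := topX topR 2 relLz.
  by congr (relL _ _ _); rewrite mulrn_pair mul0rn -mulrnA.
have h4 : relL (0, L2%:Z *+ 6) (t ^+ 3) (Qt ^+ 3).
  have := topX topR 3 relLt.
  by congr (relL _ _ _); rewrite mulrn_pair mul0rn -mulrnA.
have := topD topR (topD topR (topD topR h2 h3) h4) h1.
by rewrite (pres_equation presR) => /(top0_eq0 topR); rewrite addr0.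
Qed.

Let Qx0 : Qx`_0 = 1.
Proof.
apply: (lex_coef0 relLx); exists 1; last exact: top1 topS.
by case: hT.
Qed.

Let Qy0 : Qy`_0 = - p0.
Proof.
apply: (lex_coef0 relLy); exists (- pc); last exact: weight_top_cusp L2_gt0 hS.
by case: hT.
Qed.

Let Qz0 : Qz`_0 = 'X%:P.
Proof.
apply: (lex_coef0 relLz); exists 'X%:P; last by case: hS.
by case: hT => _ _ _ [].
Qed.

Let Qt0 : Qt`_0 = 'X.
Proof.
apply: (lex_coef0 relLt); exists 'X; last by case: hS.
by case: hT => _ _ _ [].
Qed.

Lemma invariant_poly f : phi f = f%:P -> exists q, f = embed_xzt x z t q.
Proof.
move=> inv_f; have [//|[e [r [g [e0 _ hf]]]]] := leading_form presR f.
have [w [le_w nzw]] : exists w, weight_le w g /\ weight_component w g != 0.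
  by apply: weight_exists; case: hf.
have hlex := lex_leading hf le_w.
set c := (- p0) ^+ e * _ in hlex.
have nzc : c != 0 by rewrite mulf_neq0 ?expf_neq0 ?oppr_eq0.
have hc : relL (index e r w) f c%:P by rewrite /relL inv_f; exact: poly_top_const topL hlex.
have eq_c := top_uniq topR hc (relL_leading hf le_w).
(* Since f involves y, e > 0, and Qy^e divides the nonzero constant [c%:P]. *)
have sizeQy : (size Qy <= 1)%N.
  have : (size (Qy ^+ e) <= 1)%N.
    apply: leq_trans (_ : size c%:P <= 1)%N; last exact: size_polyC_leq1.
    by apply: dvdp_leq; rewrite ?polyC_eq0 // eq_c -mulrA dvdp_mulr.
  have := size_exp Qy e; case: (size Qy) => [|[|m]] //.
  by case: e e0 {hf hlex c nzc hc eq_c} => // e _; case: (size _) => [|[|]].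
have QyE : Qy = (- p0)%:P by rewrite [Qy]size1_polyC // Qy0.
have relQ : p0%:P * Qx ^+ 2 = Qz ^+ 2 + Qt ^+ 3.
  move/eqP: relation2; rewrite QyE polyCN mulrN -addrA addrC subr_eq0 => /eqP ->.
  exact: mulrC.
have data P d0 e0' a n : relL (L1%:Z * d0, L2%:Z * e0') a P -> size P = n.+1 ->
    leading_data L1 L2 u v Qx Qz Qt P n d0 e0'.
  move=> hP szP; have nzP : P`_n != 0.
    by rewrite -[n]/(n.+1.-1) -szP -lead_coefE lead_coef_eq0 -size_poly_gt0 szP.
  have [e' [r' [g' [w' [_ _ nzw' eq_idx eqP]]]]] := invariant_leading nzP (hP n)
    (poly_top_iterate hphi topL hP (eq_leq szP)).
  exists e', r', w', (weight_component w' g'); move: eq_idx; rewrite mulrn_pair => -[eq1 eq2].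
  rewrite -QyE; split; [exact: weight_component_form | exact: eqP | exact: esym eq1 | exact: esym eq2].
have sizeS (P : {poly C}) : P != 0 -> size P = (size P).-1.+1.
  by rewrite -size_poly_gt0 => /prednK.
have nzQx : Qx != 0 by apply: contra_eqN Qx0 => /eqP->; rewrite coef0 eq_sym oner_eq0.
have nzQz : Qz != 0.
  by apply: contra_eqN Qz0 => /eqP->; rewrite coef0 eq_sym polyC_eq0 polyX_eq0.
have nzQt : Qt != 0 by apply: contra_eqN Qt0 => /eqP->; rewrite coef0 eq_sym polyX_eq0.
have datax : leading_data L1 L2 u v Qx Qz Qt Qx (size Qx).-1 (-1) 0.
  by apply: (data _ _ _ x); [rewrite mulrN1 mulr0 | exact: sizeS].
have dataz : leading_data L1 L2 u v Qx Qz Qt Qz (size Qz).-1 0 3.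
  apply: (data _ _ _ z); [|exact: sizeS].
  by rewrite mulr0 -[L2%:Z * 3]/(L2%:Z * 3%:Z) mulrC -[_ * L2%:Z]/(3%:R * _) mulr_natl.
have [szx szz szt] := @leading_forms_const k L1 L2 u v Qx Qz Qt L1_gt0 L2_gt0 Qx0 Qz0 Qt0
  relQ _ _ _ (sizeS _ nzQx) (sizeS _ nzQz) (sizeS _ nzQt) datax dataz.
by case: moves; rewrite ltnNge ?szx ?sizeQy ?szz ?szt.
Qed.
End Stage2Theory.

(** * Counting invariants *)

(* A filtration bd of C by finite-dimensional k-subspaces, with coordinate
   maps co that are injective on each step. *)
Record bounded_coordinates (k : fieldType) (C : comNzRingType) (f : k -> C)
    (bd : nat -> C -> Prop) (dim : nat -> nat)
    (co : forall m, C -> 'rV[k]_(dim m)) : Prop := BoundedCoordinates {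
  bd0 : forall m, bd m 0;
  bdD : forall m a b, bd m a -> bd m b -> bd m (a + b);
  bd_const : forall s, bd 0%N (f s);
  bdM : forall m n a b, bd m a -> bd n b -> bd (m + n)%N (a * b);
  bd_mono : forall m n a, (m <= n)%N -> bd m a -> bd n a;
  coD : forall m a b, co m (a + b) = co m a + co m b;
  coZ : forall m s a, co m (f s * a) = s *: co m a;
  co_inj : forall m a, bd m a -> co m a = 0 -> a = 0 }.

Lemma rank_kernel (F : fieldType) n d (M : 'M[F]_(n, d)) :
  (forall v : 'rV_n, v *m M = 0 -> v = 0) -> (n <= d)%N.
Proof.
move=> inj; rewrite -[n](eqP (_ : row_free M)) ?rank_leq_col //.
rewrite -kermx_eq0; apply/eqP/row_matrixP => i; rewrite row0.
by apply: inj; apply/sub_kermxP; exact: row_sub.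
Qed.

Section RankInvariants.
Variables (k : fieldType) (C : idomainType) (f : {rmorphism k -> C}).
Variables (bd : nat -> C -> Prop) (dim : nat -> nat).
Variable co : forall m, C -> 'rV[k]_(dim m).
Hypothesis hco : bounded_coordinates f bd co.

Definition combination n (c : 'I_n -> C) (v : 'rV[k]_n) : C :=
  \sum_i f (v 0 i) * c i.

Lemma bd_sum m (I : Type) (r : seq I) (c : I -> C) :
  (forall i, bd m (c i)) -> bd m (\sum_(i <- r) c i).
Proof.
move=> h; elim/big_ind: _ => //; first exact: bd0 hco m.
by move=> *; exact: bdD hco _ _ _ _ _.
Qed.

Lemma bdZ m s a : bd m a -> bd m (f s * a).
Proof. by move=> h; rewrite -[m]add0n; apply: (bdM hco) h; exact: bd_const hco s. Qed.

Lemma bdX m a n : bd m a -> bd (m * n) (a ^+ n).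
Proof.
move=> h; elim: n => [|n IHn]; last by rewrite exprS mulnS; exact: (bdM hco).
by rewrite expr0 muln0 -(rmorph1 f); exact: bd_const hco 1.
Qed.

Lemma co_combination m n (c : 'I_n -> C) (v : 'rV[k]_n) :
  v *m \matrix_i co m (c i) = co m (combination c v).
Proof.
have co0 : co m 0 = 0 by rewrite -(mul0r 0) -(rmorph0 f) (coZ hco) scale0r.
rewrite mulmx_sum_row /combination; elim/big_ind2: _ => [|a b a' b' -> ->|i _] //.
  by rewrite (coD hco).
by rewrite rowK (coZ hco).
Qed.

Lemma combination_mul n p (c : 'I_n -> C) (v : 'rV[k]_p) (B : 'M[k]_(p, n)) :
  combination c (v *m B) = combination (fun i => combination c (row i B)) v.
Proof.
rewrite /combination; under eq_bigr do rewrite mxE rmorph_sum mulr_suml.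
rewrite exchange_big; apply: eq_bigr => i _; rewrite mulr_sumr.
by apply: eq_bigr => j _; rewrite rmorphM mxE mulrA.
Qed.

(** The rank r is the dimension of a space of psi-fixed elements bounded by m. If (g_i) is a basis
    of it, the r (m+1) products g_i h^l with l <= m are independent, because psi moves h, and all
    are bounded by m + m. *)
Lemma rank_invariants n p m (c : 'I_n -> C) (U : 'M[k]_(p, n))
    (psi : {rmorphism C -> {poly C}}) (h : C) :
  (forall i, bd m (c i)) -> bd 1 h -> (1 < size (psi h))%N ->
  (forall v : 'rV_n, (v <= U)%MS -> psi (combination c v) = (combination c v)%:P) ->
  (\rank (U *m \matrix_i co m (c i)) * m.+1 <= dim (m + m))%N.
Proof.
move=> bdc bdh lt1 inv; set M := \matrix_i co m (c i).
have /submxP[K rbE] : (row_base (U *m M) <= U *m M)%MS by rewrite eq_row_base.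
pose B := K *m U; have BM : row_base (U *m M) = B *m M by rewrite rbE mulmxA.
set r := \rank (U *m M) in K rbE B BM *.
have freeB (v : 'rV_r) : combination c (v *m B) = 0 -> v = 0.
  move=> v0; apply: (row_free_inj (row_base_free (U *m M))).
  rewrite BM mul0mx mulmxA co_combination v0.
  by rewrite -(mul0r 0) -(rmorph0 f) (coZ hco) scale0r.
pose g i := combination c (row i B).
have bdg i : bd m (g i) by apply: bd_sum => j; exact: bdZ.
pose e (il : 'I_r * 'I_m.+1) := g il.1 * h ^+ il.2.
have bde il : bd (m + m) (e il).
  apply: (bdM hco); first exact: bdg.
  apply: (bd_mono hco (leq_ord il.2)).
  by have := bdX il.2 bdh; rewrite mul1n.
have -> : (r * m.+1 = #|{: 'I_r * 'I_m.+1}|)%N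
  by rewrite card_prod !card_ord.
pose e' (i : 'I_#|{: 'I_r * 'I_m.+1}|) := e (enum_val i).
apply: (@rank_kernel k _ _ (\matrix_i co (m + m) (e' i))) => v.
rewrite co_combination => /(co_inj hco) v0.
have {v0} : combination e' v = 0 by apply: v0; apply: bd_sum => i; exact: bdZ (bde _).
pose w l := \row_i v 0 (enum_rank (i, l) : 'I_#|{: 'I_r * 'I_m.+1}|).
have -> : combination e' v = \sum_l combination g (w l) * h ^+ l.
  rewrite /combination (reindex enum_rank) /=; last exact: onW_bij (enum_rank_bij _).
  transitivity (\sum_i \sum_l f (v 0 (enum_rank (i, l))) * g i * h ^+ l).
    by rewrite pair_bigA; apply: eq_bigr => -[i l] _; rewrite /e' enum_rankK /e mulrA.
  rewrite exchange_big; apply: eq_bigr => l _; rewrite mulr_suml.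
  by apply: eq_bigr => i _; rewrite mxE.
have gE l : combination g (w l) = combination c (w l *m B) by rewrite combination_mul.
have invg l : psi (combination g (w l)) = (combination g (w l))%:P.
  by rewrite gE; apply: inv; rewrite /B mulmxA submxMl.
move/(congr1 psi); rewrite rmorph0 rmorph_sum /= => sum0.
(* Under psi the relation becomes a polynomial over C composed with psi(h), and composition with a
   nonconstant polynomial is injective. *)
have q0 : \poly_(l < m.+1) combination g (w (inord l)) = 0.
  apply/eqP; rewrite -(comp_poly_eq0 _ lt1) poly_def raddf_sum -[X in _ == X]sum0.
  apply/eqP; apply: eq_bigr => l _ /=.
  by rewrite rmorphM invg rmorphXn comp_polyZ comp_Xn_poly mul_polyC inord_val.
apply/rowP => j; rewrite mxE -[j]enum_valK; case: (enum_val j) => i l.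
have : combination g (w l) = 0.
  have := congr1 (fun q : {poly C} => q`_l) q0.
  by rewrite coef_poly ltn_ord coef0 inord_val.
by rewrite gE => /freeB/rowP/(_ i); rewrite !mxE.
Qed.
End RankInvariants.

(** The factor 4 is the square of 2 in 2mN + 1 <= 2(mN + 1). Cancelling one mN + 1, the right side
    is at most 4 (s+1)(m+1)(N+1)^2 = N (N+1)^2, below (N+1)^3. *)
Lemma counting_arith s m (N := (4 * (s.+1 * m.+1))%N) :
  ~ (N.+1 * N.+1 * N.+1 * (m * N).+1 <=
     (s * N).+1 * ((m * N + m * N).+1 * (m * N + m * N).+1))%N.
Proof.
set x := (m * N).+1 => le1.
have le2 : ((m * N + m * N).+1 * (m * N + m * N).+1 <= 4 * x * x)%N.
  have le_x : ((m * N + m * N).+1 <= 2 * x)%N by rewrite /x; move: (m * N)%N => y; lia.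
  apply: leq_trans (leq_mul le_x le_x) _.
  by move: x {le1 le_x} => x; lia.
have le3 : (N.+1 * N.+1 * N.+1 <= (s * N).+1 * 4 * x)%N.
  rewrite -(@leq_pmul2r x) //; apply: leq_trans le1 _.
  have -> : ((s * N).+1 * 4 * x * x = (s * N).+1 * (4 * x * x))%N by rewrite !mulnA.
  by rewrite leq_mul2l le2 orbT.
have le4 : ((s * N).+1 <= s.+1 * N.+1)%N by move: N {x le1 le2 le3} => n; nia.
have le5 : (x <= m.+1 * N.+1)%N by rewrite /x; move: N {x le1 le2 le3 le4} => n; nia.
have le6 : ((s * N).+1 * 4 * x <= N * N.+1 * N.+1)%N.
  apply: leq_trans (leq_mul (leq_mul le4 (leqnn 4)) le5) _.
  by rewrite {2}/N; move: (N.+1) => n; lia.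
by have := leq_trans le3 le6; rewrite !leq_pmul2r // ltnn.
Qed.

Section Counting.
Variables (k : fieldType) (C : idomainType) (f : {rmorphism k -> C}).
Variables (bd : nat -> C -> Prop).
Variable co : forall m, C -> 'rV[k]_(m.+1 * m.+1).
Hypothesis hco : bounded_coordinates f bd co.
Hypothesis bd_exists : forall c, exists m, bd m c.

Variables (R : comAlgType k) (E : {rmorphism {poly C} -> R}).
Hypothesis E_scalar : forall s, E (f s)%:P = s%:A.
Hypothesis E_inj : forall q, E q = 0 -> q = 0.
Hypothesis pole_exists : forall a, exists M q, E 'X ^+ M * a = E q.

(* x^M a is a polynomial in x with coefficients bounded by m. *)
Definition pole_bound (M m : nat) (a : R) : Prop :=
  exists q, E 'X ^+ M * a = E q /\ forall i, bd m q`_i.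

Lemma pole_bound_mono M m M' m' a :
  (M <= M')%N -> (m <= m')%N -> pole_bound M m a -> pole_bound M' m' a.
Proof.
move=> leM lem [q [aE bdq]]; exists ('X^(M' - M) * q); split.
  by rewrite rmorphM rmorphXn -aE mulrA -exprD subnK.
move=> i; rewrite coefXnM; case: ltnP => _; first exact: bd0 hco _.
exact: (bd_mono hco) (bdq _).
Qed.

Lemma pole_bound0 M m : pole_bound M m 0.
Proof. by exists 0; rewrite mulr0 rmorph0; split=> // i; rewrite coef0; exact: bd0 hco m. Qed.

Lemma pole_boundD M m a b : pole_bound M m a -> pole_bound M m b -> pole_bound M m (a + b).
Proof.
move=> [q [aE bdq]] [q' [bE bdq']]; exists (q + q').
by split=> [|i]; [rewrite mulrDr rmorphD aE bE | rewrite coefD; exact: (bdD hco)].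
Qed.

Lemma pole_boundM M m M' m' a b :
  pole_bound M m a -> pole_bound M' m' b -> pole_bound (M + M') (m + m') (a * b).
Proof.
move=> [q [aE bdq]] [q' [bE bdq']]; exists (q * q').
split=> [|i]; first by rewrite exprD mulrACA aE bE rmorphM.
by rewrite coefM; apply: (bd_sum hco) => j; exact: (bdM hco).
Qed.

Lemma pole_bound1 : pole_bound 0 0 1.
Proof.
exists 1; rewrite expr0 mulr1 rmorph1; split=> // i; rewrite coef1.
case: (i == 0%N) => /=; last exact: bd0 hco _.
by have := bd_const hco 1; rewrite rmorph1.
Qed.

Lemma pole_bound_exists a : exists M m, pole_bound M m a.
Proof.
have [M [q aE]] := pole_exists a; exists M.
suff [m hm] : exists m, forall i, bd m q`_i by exists m, q.
elim/poly_ind: q {aE} => [|q c [m hm]].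
  by exists 0%N => i; rewrite coef0; exact: bd0 hco _.
have [m' hm'] := bd_exists c; exists (m + m')%N => i.
rewrite coefD coefMX coefC; apply: (bdD hco); case: (i == 0%N); try exact: bd0 hco _.
  by apply: (bd_mono hco) (hm _); exact: leq_addr.
by apply: (bd_mono hco) hm'; exact: leq_addl.
Qed.

Definition poly_pole_bound M m (P : {poly R}) : Prop := forall n, pole_bound M m P`_n.

Lemma poly_pole_bound_exists P : exists M m, poly_pole_bound M m P.
Proof.
elim/poly_ind: P => [|P a [M [m hP]]].
  by exists 0%N, 0%N => n; rewrite coef0; exact: pole_bound0.
have [M' [m' ha]] := pole_bound_exists a; exists (M + M')%N, (m + m')%N => n.
rewrite coefD coefMX coefC; apply: pole_boundD; case: (n == 0%N); try exact: pole_bound0.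
  by apply: pole_bound_mono (hP _); exact: leq_addr.
by apply: pole_bound_mono ha; exact: leq_addl.
Qed.

Lemma poly_pole_boundM M m M' m' P Q : poly_pole_bound M m P -> poly_pole_bound M' m' Q ->
  poly_pole_bound (M + M') (m + m') (P * Q).
Proof.
move=> hP hQ n; rewrite coefM; elim/big_ind: _ => [|a b|j _]; first exact: pole_bound0.
  exact: pole_boundD.
exact: pole_boundM.
Qed.

Lemma poly_pole_boundX M m P n : poly_pole_bound M m P ->
  poly_pole_bound (M * n) (m * n) (P ^+ n).
Proof.
move=> hP; elim: n => [|n IHn]; last by rewrite exprS !mulnS; exact: poly_pole_boundM.
move=> n; rewrite expr0 !muln0 coef1; case: (n == 0%N); first exact: pole_bound1.
exact: pole_bound0.
Qed.

Variable phi : {rmorphism R -> {poly R}}.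
Hypothesis hphi : exponential_map phi.
Variables (psi : {rmorphism C -> {poly C}}) (h : C).
Hypotheses (bdh : bd 1 h) (psih : (1 < size (psi h))%N).
Hypothesis invariant_restriction : forall a, phi a = a%:P ->
  exists q, [/\ a = E q, psi q`_0 = (q`_0)%:P & q`_0 = 0 -> q = 0].

(* U j is the space of combinations whose image under phi has degree at most
   S - j; the leading coefficients of U j modulo U j.+1 restrict to fixed
   elements of C. *)
Lemma family_bound n (b : 'I_n -> R) (M m S : nat) :
  (forall s : 'I_n -> k, \sum_i s i *: b i = 0 -> forall i, s i = 0) ->
  (forall i, poly_pole_bound M m (phi (b i))) ->
  (forall i, size (phi (b i)) <= S.+1)%N ->
  (n * m.+1 <= S.+1 * ((m + m).+1 * (m + m).+1))%N.
Proof.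
move=> free pole_b size_b.
have /choice[q hq] : forall il : 'I_n * nat, exists q,
    E 'X ^+ M * (phi (b il.1))`_il.2 = E q /\ forall i, bd m q`_i.
  by move=> il; exact: pole_b.
pose elt (v : 'rV[k]_n) := \sum_i v 0 i *: b i.
have coef_elt v d : (phi (elt v))`_d = \sum_i v 0 i *: (phi (b i))`_d.
  rewrite rmorph_sum coef_sum; apply: eq_bigr => i _.
  by rewrite -[v 0 i *: _]mulr_algl rmorphM (exponential_map_alg hphi) coefCM mulr_algl.
(* Individual coefficients of phi(b_i) may have poles along x = 0. After clearing them by x^M, the
   coefficient of x^M computes the restriction to x = 0 of any combination that lies in the image of
   E. *)
pose c d (i : 'I_n) := (q (i, d))`_M.
have comb_elt v d a : (phi (elt v))`_d = E a -> combination f (c d) v = a`_0.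
  move=> eltE; pose Q := \sum_i (f (v 0 i))%:P * q (i, d).
  have QE : E Q = E ('X^M * a).
    rewrite [RHS]rmorphM rmorphXn -eltE coef_elt mulr_sumr rmorph_sum.
    apply: eq_bigr => i _; rewrite rmorphM E_scalar mulr_algl.
    by have [<- _] := hq (i, d); rewrite scalerAr.
  have {}QE : Q = 'X^M * a.
    by apply/eqP; rewrite -subr_eq0; apply/eqP/E_inj; rewrite rmorphB QE subrr.
  have : Q`_M = a`_0 by rewrite QE coefXnM ltnn subnn.
  by move=> <-; rewrite coef_sum; apply: eq_bigr => i _; rewrite coefCM.
pose F d := \matrix_i co m (c d i).
pose U := fix U j : 'M[k]_n := if j is j'.+1 then (U j' :&: kermx (F (S - j')%N))%MS else 1%:M.
have US j : U j.+1 = (U j :&: kermx (F (S - j)%N))%MS by [].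
have bdc d i : bd m (c d i) by have [_] := hq (i, d); apply.
(* If all coefficients above S - j vanish, the coefficient at S - j is on top and hence invariant by
   iterativity. *)
have invar j v : (forall d, (S < d + j)%N -> (phi (elt v))`_d = 0) -> (j <= S)%N ->
    exists a, [/\ (phi (elt v))`_(S - j) = E a, psi a`_0 = (a`_0)%:P & a`_0 = 0 -> a = 0].
  move=> vanish lejS; apply: invariant_restriction; apply/polyP => i.
  rewrite (exponential_map_iterative hphi) coefC; case: i => [|i] /=; first by rewrite bin0.
  by rewrite vanish ?mul0rn //; lia.
have vanish j : (j <= S.+1)%N -> forall v : 'rV_n, (v <= U j)%MS ->
    forall d, (S < d + j)%N -> (phi (elt v))`_d = 0.
  elim: j => [_ v _ d|j IHj lejS v].
    rewrite addn0 => lt_d; rewrite coef_elt big1 // => i _.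
    by rewrite nth_default ?scaler0 // (leq_trans (size_b i)).
  rewrite US sub_capmx => /andP[vU /sub_kermxP vF] d.
  have vanish_j := IHj (ltnW lejS) v vU.
  rewrite addnS ltnS leq_eqVlt => /orP[/eqP eq_d|]; last exact: vanish_j.
  have -> : d = (S - j)%N by lia.
  have [a [aE _ a0]] := invar j v vanish_j lejS.
  (* Being in the kernel of F means that the restriction to x = 0 vanishes, and restriction is
     injective on invariants. *)
  rewrite aE a0 ?rmorph0 // -(comb_elt _ _ _ aE); apply: (co_inj hco (m := m)).
    by apply: (bd_sum hco) => i; exact: (bdZ hco).
  by rewrite -(co_combination hco).
have rank_step j : (j <= S)%N ->
    (\rank (U j) * m.+1 <= \rank (U j.+1) * m.+1 + (m + m).+1 * (m + m).+1)%N.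
  (* The drop in rank from U j to U j.+1 is the rank of the restricted top coefficients, bounded by
     [rank_invariants]. *)
  move=> lejS; rewrite -(mxrank_mul_ker (U j) (F (S - j)%N)) mulnDl addnC -US leq_add2l.
  apply: (rank_invariants hco) bdh psih _ => [i|v vU]; first exact: bdc.
  have [a [aE inv_a _]] := invar j v (vanish j (leqW lejS) v vU) lejS.
  by rewrite (comb_elt _ _ _ aE).
have rank_le j : (j <= S.+1)%N ->
    (n * m.+1 <= \rank (U j) * m.+1 + j * ((m + m).+1 * (m + m).+1))%N.
  elim: j => [_|j IHj lejS]; first by rewrite mxrank1 addn0.
  apply: leq_trans (IHj (ltnW lejS)) _.
  by rewrite [(j.+1 * _)%N]mulSn addnA leq_add2r; exact: rank_step.
have := rank_le S.+1 (leqnn _); suff -> : U S.+1 = 0 by rewrite mxrank0.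
apply/row_matrixP => i; rewrite row0; set v := row i _.
(* In U S.+1 even the coefficient of index 0 vanishes, and that coefficient is the element
   itself. *)
have elt0 : elt v = 0.
  rewrite -[elt v](exponential_map_eval0 hphi) horner_coef0.
  by apply: (vanish S.+1 (leqnn _)); rewrite ?row_sub ?add0n.
by apply/rowP => l; rewrite [RHS]mxE; exact: free (fun l => v 0 l) elt0 l.
Qed.

(** For exponents up to N, the U-degrees, pole orders and coefficient bounds of the monomials all
    grow linearly in N. [family_bound] then allows only O(N^2) of the (N+1)^3 independent
    monomials. *)
Lemma counting_absurd (b1 b2 b3 : R) :
  (forall N (s : 'I_N -> 'I_N -> 'I_N -> k),
    \sum_(a < N) \sum_(b < N) \sum_(c < N) s a b c *: (b1 ^+ a * b2 ^+ b * b3 ^+ c) = 0 ->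
    forall a b c, s a b c = 0) -> False.
Proof.
move=> free.
have [M1 [m1 pole1]] := poly_pole_bound_exists (phi b1).
have [M2 [m2 pole2]] := poly_pole_bound_exists (phi b2).
have [M3 [m3 pole3]] := poly_pole_bound_exists (phi b3).
pose s0 := (size (phi b1) + size (phi b2) + size (phi b3))%N.
pose m0 := (m1 + m2 + m3)%N; pose M0 := (M1 + M2 + M3)%N.
pose N := (4 * (s0.+1 * m0.+1))%N.
pose I := ('I_N.+1 * 'I_N.+1 * 'I_N.+1)%type.
pose b (i : 'I_#|{: I}|) := let: (u, v, w) := enum_val i : I in
  b1 ^+ u * b2 ^+ v * b3 ^+ w.
have : (#|{: I}| * (m0 * N).+1 <= (s0 * N).+1 * ((m0 * N + m0 * N).+1 * (m0 * N + m0 * N).+1))%N.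
  apply: (@family_bound _ b (M0 * N) (m0 * N) (s0 * N)) => [s|i|i].
  - pose s' u v w := s (enum_rank ((u, v, w) : I)).
    move=> sum0 i; rewrite -[i]enum_valK; case: (enum_val i) => -[u v] w.
    apply: (free _ s'); rewrite -[RHS]sum0 [RHS](reindex enum_rank) /=; last first.
      exact: onW_bij (enum_rank_bij _).
    rewrite pair_bigA pair_bigA; apply: eq_bigr => -[[u' v'] w'] _ /=.
    by rewrite /b enum_rankK.
  - rewrite /b; case: (enum_val i) => -[u v] w; rewrite !rmorphM !rmorphXn => d.
    have hP := poly_pole_boundM (poly_pole_boundM (poly_pole_boundX u pole1)
      (poly_pole_boundX v pole2)) (poly_pole_boundX w pole3).
    have leN (t : 'I_N.+1) a : (a * t <= a * N)%N by rewrite leq_mul2l leq_ord orbT.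
    by apply: pole_bound_mono (hP d); rewrite !mulnDl !leq_add.
  - rewrite /b; case: (enum_val i) => -[u v] w; rewrite !rmorphM !rmorphXn.
    have sizeX (P : {poly R}) (t : 'I_N.+1) : (size (P ^+ t) <= (size P * N).+1)%N.
      apply: leq_trans (size_poly_exp_leq _ _) _; rewrite ltnS leq_mul ?leq_pred //.
      exact: leq_ord.
    have h1 := sizeX (phi b1) u; have h2 := sizeX (phi b2) v; have h3 := sizeX (phi b3) w.
    apply: leq_trans (size_polyMleq _ _) _; have h4 := size_polyMleq (phi b1 ^+ u) (phi b2 ^+ v).
    have arith (A B AB D a b' d : nat) : (A <= a.+1 -> B <= b'.+1 -> D <= d.+1 ->
      AB <= (A + B).-1 -> (AB + D).-1 <= (a + b' + d).+1)%N by lia.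
    by rewrite /s0 !mulnDl; exact: arith h1 h2 h3 h4.
rewrite !card_prod !card_ord; apply: counting_arith.
Qed.
End Counting.

(** * The two inclusions *)

Section BidegreeCoordinates.
Variable k : fieldType.
Local Notation C := {poly {poly k}}.

Definition bidegree_le (m : nat) (g : C) : Prop :=
  (size g <= m.+1)%N /\ forall c, (size (g`_c)%R <= m.+1)%N.

Definition bidegree_coordinates m (g : C) : 'rV[k]_(m.+1 * m.+1) :=
  mxvec (\matrix_(c < m.+1, b < m.+1) g`_c`_b).

Lemma bidegree_bounded :
  bounded_coordinates (@kC k) bidegree_le bidegree_coordinates.
Proof.
split.
- by move=> m; split=> [|c]; rewrite ?coef0 size_poly0.
- move=> m a b [sa ca] [sb cb]; split=> [|c].
    by apply: leq_trans (size_polyD _ _) _; rewrite geq_max sa.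
  by rewrite coefD; apply: leq_trans (size_polyD _ _) _; rewrite geq_max ca cb.
- move=> s; split=> [|c]; first exact: size_polyC_leq1.
  by rewrite coefC; case: (c == 0%N); rewrite ?size_poly0 // size_polyC_leq1.
- move=> m n a b [sa ca] [sb cb].
  have arith (u v w : nat) : (u <= m.+1 -> v <= n.+1 -> w <= (u + v).-1 -> w <= (m + n).+1)%N.
    by lia.
  split=> [|c]; first exact: arith sa sb (size_polyMleq _ _).
  rewrite coefM; elim/big_ind: _ => [|u v su sv|i _]; first by rewrite size_poly0.
    by apply: leq_trans (size_polyD _ _) _; rewrite geq_max su.
  exact: arith (ca _) (cb _) (size_polyMleq _ _).
- move=> m n a lemn [sa ca]; split=> [|c]; first exact: leq_trans sa _.
  exact: leq_trans (ca c) _.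
- move=> m a b; rewrite /bidegree_coordinates -linearD; congr mxvec.
  by apply/matrixP => i j; rewrite !mxE coefD coefD.
- move=> m s a; rewrite /bidegree_coordinates -linearZ; congr mxvec; apply/matrixP => i j.
  by rewrite !mxE coefCM coefCM.
- move=> m a [sa ca] /eqP; rewrite /bidegree_coordinates mxvec_eq0 => /eqP/matrixP co0.
  apply/polyP => c; rewrite coef0; have [lt_c|le_c] := ltnP c m.+1; last first.
    by rewrite nth_default // (leq_trans sa).
  apply/polyP => b; rewrite coef0; have [lt_b|le_b] := ltnP b m.+1; last first.
    by rewrite nth_default // (leq_trans (ca c)).
  by have := co0 (Ordinal lt_c) (Ordinal lt_b); rewrite !mxE.
Qed.

Lemma bidegree_le_exists (g : C) : exists m, bidegree_le m g.
Proof.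
by have [n [sg cg]] := bidegree_bound g; exists n; split=> [|c]; exact: leqW.
Qed.
End BidegreeCoordinates.

Section Presented.
Variables (k : fieldType) (R : comAlgType k) (x y z t : R) (eta : {poly k}).
Hypothesis presR : presentation x y z t eta.
Local Notation C := {poly {poly k}}.
Local Notation emb := (embed_zt z t : {rmorphism C -> R}).
Local Notation E := (embed_xzt x z t : {rmorphism {poly C} -> R}).

Let pole1 : exists T, pole_top x y z t eta 1 T.
Proof. exact: (@pole_top_exists k C (@kC k) 1 R x y z t eta 'X%:P 'X presR isT). Qed.

Lemma pres_top_neq0 T a : pole_top x y z t eta 1 T -> a != 0 ->
  exists d c, c != 0 /\ T d a c.
Proof.
move=> hT /(leading_form_neq0 presR)[e [r [g ha]]].
exists (1%N%:Z * ((2 * e)%:Z - r%:Z)), ((- ('X%:P ^+ 2 + 'X ^+ 3 + kC eta`_0)) ^+ e * g).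
split; last exact: (pole_top_leading _ hT ha).
by rewrite mulf_neq0 ?expf_neq0 ?oppr_eq0 ?pc_neq0 //; case: ha.
Qed.

(** R is a domain because leading components multiply in the domain k[z,t]. *)
Lemma pres_mul_neq0 (a b : R) : a != 0 -> b != 0 -> a * b != 0.
Proof.
have [T hT] := pole1; have topT : top_rel int_pos T by case: hT.
move=> /(pres_top_neq0 hT)[d [c [nzc hc]]] /(pres_top_neq0 hT)[d' [c' [nzc' hc']]].
apply/eqP => ab0; have := topM topT hc hc'; rewrite ab0 => /(top0_eq0 topT)/eqP.
by rewrite mulf_eq0 (negPf nzc) (negPf nzc').
Qed.

Lemma pres_x_neq0 : x != 0.
Proof.
have [T [topT Tx _ _]] := pole1; apply/eqP => x0; rewrite x0 in Tx.
by have /eqP := top0_eq0 topT Tx; rewrite oner_eq0.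
Qed.

Lemma pres_embed_inj q : E q = 0 -> q = 0.
Proof.
move=> Eq0; apply/eqP/negPn/negP => nzq.
have [T hT] := pole1; have topT : top_rel int_pos T by case: hT.
have [r [hr _]] := x_leading_poly emb x y nzq.
have := pole_top_leading (isT : (0 < 1)%N) hT hr.
rewrite expr0 mul1r -[ev1 _ _ q]/(E q) Eq0 => /(top0_eq0 topT)/eqP.
by case: hr => /negPf->.
Qed.

(** Each factor y is absorbed by x^2 through the defining relation. *)
Lemma pres_pole (a : R) : exists M q, x ^+ M * a = E q.
Proof.
have [h <-] := pres_surj presR a.
have addP (a1 a2 : R) : (exists M q, x ^+ M * a1 = E q) ->
    (exists M q, x ^+ M * a2 = E q) -> exists M q, x ^+ M * (a1 + a2) = E q.
  move=> [M1 [q1 e1]] [M2 [q2 e2]]; exists (M1 + M2)%N, ('X^M2 * q1 + 'X^M1 * q2).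
  rewrite rmorphD !rmorphM !rmorphXn -e1 -e2 /= embed_xztX mulrDr.
  by rewrite !mulrA -!exprD [(M2 + M1)%N]addnC.
rewrite [embed_xyzt _ _ _ _ _](ev1E _ _ (leqnn _)).
elim/big_ind: _ => [|a1 a2|i _]; [|exact: addP|].
  by exists 0%N, 0; rewrite mulr0 rmorph0.
exists (2 * i)%N, (h`_i * (- zt_part eta) ^+ i).
rewrite mulrCA exprM -exprMn (pres_rel presR).
have morphE (A : comNzRingType) (g : {rmorphism A -> R}) (p q : A) n :
  g p * (- g q) ^+ n = g (p * (- q) ^+ n) by rewrite rmorphM rmorphXn rmorphN.
exact: (morphE _ E h`_i (zt_part eta) i).
Qed.

Lemma monomials_free N (s : 'I_N -> 'I_N -> 'I_N -> k) :
  \sum_(a < N) \sum_(b < N) \sum_(c < N) s a b c *: (x ^+ a * z ^+ b * t ^+ c) = 0 ->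
  forall a b c, s a b c = 0.
Proof.
move=> sum0 a b c.
pose Q : {poly C} := \sum_(a < N) \sum_(b < N) \sum_(c < N)
  ((s a b c *: 'X^b) *: 'X^c) *: 'X^a.
have Q0 : Q = 0.
  apply: pres_embed_inj; rewrite -[RHS]sum0 rmorph_sum; apply: eq_bigr => a' _.
  rewrite rmorph_sum; apply: eq_bigr => b' _; rewrite rmorph_sum; apply: eq_bigr => c' _.
  rewrite -!mul_polyC !rmorphM !rmorphXn /= embed_xztX !embed_xztC.
  rewrite -[embed_zt z t (s a' b' c')%:P%:P]/(embed_zt z t (kC _)) embed_zt_alg.
  by rewrite embed_zt_z embed_zt_t -!mulrA mulr_algl; congr (_ *: _); ring.
(* Writing the coefficient as a threefold Kronecker sum lets it be matched with the coefficient of Q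
   term by term. *)
have sum1 (V : zmodType) (F : 'I_N -> V) (i : 'I_N) : \sum_j F j *+ (i == j :> nat) = F i.
  rewrite (bigD1 i) //= eqxx big1 ?addr0 // => j ne_ji.
  by rewrite [_ == _](negbTE _) // eq_sym.
have := congr1 (fun q : {poly C} => q`_a`_c`_b) Q0; rewrite !coef0 => <-.
rewrite -[LHS](sum1 _ (fun a' => s a' b c)) !coef_sum; apply: eq_bigr => a' _.
rewrite -(sum1 _ (fun b' => s a' b' c)) !coef_sum -sumrMnl; apply: eq_bigr => b' _.
rewrite -(sum1 _ (fun c' => s a' b' c')) !coef_sum -!sumrMnl; apply: eq_bigr => c' _.
rewrite coefZ coefXn mulr_natr !coefMn coefZ coefXn mulr_natr coefMn coefZ coefXn mulr_natr.
by rewrite -!mulrnA; congr (_ *+ _); rewrite mulnC mulnA [X in (X * _)%N]mulnC -mulnA mulnC.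
Qed.

Variable phi : {rmorphism R -> {poly R}}.
Hypothesis hphi : exponential_map phi.
Hypothesis moves : exists a, phi a <> a%:P.

Lemma invariants_in_xzt f : phi f = f%:P -> exists q, f = E q.
Proof.
have [L [u [T [Px [Py [Pz [Pt [[L0 hT] [hPx hPy] [hPz hPt] mv]]]]]]]] := stage1 presR hphi moves.
have [_ Tx Ty [Tz Tt _]] := hT.
have c0 := @stage1_coef0 k R x y z t eta phi hphi L u T hT.
have [L2 [v [S [Qx [Qy [Qz [Qt [[L20 hS] [hQx hQy] [hQz hQt] mv2]]]]]]]] :=
  stage2 (c0 _ _ _ _ hPx Tx) (c0 _ _ _ _ hPy Ty) (c0 _ _ _ _ hPz Tz) (c0 _ _ _ _ hPt Tt) mv.
exact: (@invariant_poly k R x y z t eta presR phi hphi L u T Px Py Pz Pt L0 hT hPx hPy hPz hPt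
  L2 v S Qx Qy Qz Qt L20 hS hQx hQy hQz hQt mv2 f).
Qed.

(** U-degrees add in a domain, so a factor of a nonzero invariant has U-degree 0 and is itself
    invariant. *)
Lemma x_not_dividing_invariant (f g : R) : phi x <> x%:P -> phi f = f%:P -> f = g * x -> f = 0.
Proof.
move=> move_x inv_f fE; apply/eqP/negPn/negP => nzf.
have lead_neq0 (a : R) : a != 0 -> lead_coef (phi a) != 0.
  move=> nza; rewrite lead_coef_eq0; apply: contraNneq nza => phi_a.
  by rewrite -(phi0 hphi a) phi_a coef0.
have nzg : g != 0 by apply: contraNneq nzf => g0; rewrite fE g0 mul0r.
have := congr1 (fun P : {poly R} => size P) inv_f; rewrite /= size_polyC nzf fE rmorphM.
rewrite size_proper_mul; last by apply: pres_mul_neq0; apply: lead_neq0; rewrite ?pres_x_neq0.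
have gt_x : (1 < size (phi x))%N.
  by rewrite ltnNge; apply/negP => /(phi_size1 hphi).
have gt_g : (0 < size (phi g))%N by rewrite size_poly_gt0 -lead_coef_eq0 lead_neq0.
have arith (m n : nat) : (1 < n -> 0 < m -> (m + n).-1 <> 1)%N by lia.
by move/(arith _ _ gt_x gt_g).
Qed.

Lemma x_invariant : phi x = x%:P.
Proof.
have [//|move_x] := pselect (phi x = x%:P); exfalso.
have [L [u [T [Px [Py [Pz [Pt [[L0 hT] [hPx hPy] [hPz hPt] mv]]]]]]]] := stage1 presR hphi moves.
have [topT Tx Ty [Tz Tt _]] := hT.
have c0 := @stage1_coef0 k R x y z t eta phi hphi L u T hT.
pose psi := stage1_subst Pz Pt.
(* One of z, t is moved by psi: otherwise the relation makes Px^2 Py a nonzero constant, and all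
   four leading parts would be constant, against [mv]. *)
have [h [bdh lt_h]] : exists h, bidegree_le 1 h /\ (1 < size (psi h))%N.
  have [lt_z|le_z] := ltnP 1 (size Pz).
    exists 'X%:P; rewrite /psi /stage1_subst /= ev2z; split=> //; split=> [|c].
      exact: leq_trans (size_polyC_leq1 _) _.
    by rewrite coefC; case: (c == 0%N); rewrite ?size_poly0 ?size_polyX.
  have [lt_t|le_t] := ltnP 1 (size Pt).
    exists 'X; rewrite /psi /stage1_subst /= ev2t; split=> //; split=> [|c].
      by rewrite size_polyX.
    by rewrite coefX; case: (c == 1%N); rewrite ?size_poly0 ?size_poly1.
  exfalso.
  have Pz0 := c0 _ _ _ _ hPz Tz; have Pt0 := c0 _ _ _ _ hPt Tt.
  pose pc : C := 'X%:P ^+ 2 + 'X ^+ 3 + kC eta`_0.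
  have PzE : Pz = 'X%:P%:P by rewrite [Pz]size1_polyC // Pz0.
  have PtE : Pt = 'X%:P by rewrite [Pt]size1_polyC // Pt0.
  have opp_sum (V : zmodType) (a b c d : V) : a + b + c + d = 0 -> a = - (b + c + d).
    by rewrite -!addrA => /eqP; rewrite addr_eq0 => /eqP.
  have rel : Px ^+ 2 * Py = (- pc)%:P.
    rewrite (opp_sum _ _ _ _ _ (stage1_relation presR hphi L0 hT hPx hPy hPz hPt)).
    by rewrite polyCN /pc polyCD polyCD !polyC_exp PzE PtE.
  have nz : Px ^+ 2 * Py != 0 by rewrite rel polyC_eq0 oppr_eq0 pc_neq0.
  have size1 : size (Px ^+ 2 * Py) = 1%N by rewrite rel size_polyC oppr_eq0 pc_neq0.
  move: (nz); rewrite mulf_eq0 negb_or => /andP[nzx2 nzy].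
  rewrite size_mul // in size1.
  have [szx2 szy] : size (Px ^+ 2) = 1%N /\ size Py = 1%N.
    by apply: predn_add_eq1 size1; rewrite size_poly_gt0.
  have szx : (size Px <= 1)%N.
    by have := size_exp Px 2; rewrite szx2; case: (size Px) => [|[|m]] //; rewrite muln2.
  by case: mv; rewrite ltnNge ?szx ?szy ?le_z ?le_t.
have restr a : phi a = a%:P -> exists q, [/\ a = E q, psi q`_0 = (q`_0)%:P & q`_0 = 0 -> q = 0].
  move=> inv_a; have [q aE] := invariants_in_xzt inv_a; exists q.
  have q00 : q`_0 = 0 -> q = 0.
    (* If the restriction to x = 0 is zero, then x divides the invariant a. *)
    move=> q0; apply: pres_embed_inj; rewrite -aE.
    apply: (@x_not_dividing_invariant a (E (drop_poly 1 q)) move_x inv_a).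
    have qE : q = drop_poly 1 q * 'X.
      rewrite -{1}(poly_take_drop 1 q) -[RHS]add0r; congr (_ + _).
      by apply/polyP => i; rewrite coef_take_poly coef0; case: i.
    by rewrite aE {1}qE rmorphM /= embed_xztX.
  split=> //; have [->|nz0] := eqVneq q`_0 0; first by rewrite rmorph0.
  have nzq : q != 0 by apply: contraNneq nz0 => ->; rewrite coef0.
  (* A nonzero restriction q_0 is the leading form of a, with e = r = 0. As phi(a) = a, its image
     under psi and q_0 itself are both the leading part of phi(a). *)
  have [r [hr r0]] := x_leading_poly emb x y nzq; rewrite (r0 nz0) in hr.
  have ha : x_leading emb x y 0 0 q`_0 a by rewrite aE.
  have h1 := stage1_leading hphi L0 hT hPx hPy hPz hPt ha.
  have h2 := poly_top_const u topT (pole_top_leading L0 hT ha).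
  rewrite -inv_a in h2.
  have := top_uniq (top_poly topT u) h1 h2.
  by rewrite !expr0 !mul1r.
have E_scalar s : E (kC s)%:P = s%:A by rewrite /= embed_xztC embed_zt_alg.
have poles a : exists M q, E 'X ^+ M * a = E q by rewrite /= embed_xztX; exact: pres_pole.
exact: (@counting_absurd k C (@kC k) (@bidegree_le k) (@bidegree_coordinates k)
  (bidegree_bounded k) (@bidegree_le_exists k) R E E_scalar pres_embed_inj poles
  phi hphi psi h bdh lt_h restr x z t monomials_free).
Qed.
End Presented.

Lemma embed_xzt_generated (k : fieldType) (R : comAlgType k) (x z t : R) (A : set R) q :
  GRing.subalg_closed (mem A) -> [set x; z; t] `<=` A -> A (embed_xzt x z t q).
Proof.
case=> A1 Alin AM genA.
have Ax : A x by apply: genA; left; left.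
have Az : A z by apply: genA; left; right.
have At : A t by apply: genA; right.
have in_A a : A a -> a \in mem A by move=> h; rewrite inE.
have mulA a b : A a -> A b -> A (a * b).
  by move=> ha hb; have := AM a b (in_A _ ha) (in_A _ hb); rewrite inE.
have addA a b : A a -> A b -> A (a + b).
  by move=> ha hb; have := Alin 1 a b (in_A _ ha) (in_A _ hb); rewrite scale1r inE.
have A_1 : A 1 by move: A1; rewrite inE.
have A0 : A 0.
  by have := Alin (-1) 1 1 (in_A _ A_1) (in_A _ A_1); rewrite scaleN1r addNr inE.
have scalarA s : A s%:A.
  by have := Alin s 1 0 (in_A _ A_1) (in_A _ A0); rewrite addr0 inE.
have ev1_in (B : comNzRingType) (f : {rmorphism B -> R}) u p :
    (forall b, A (f b)) -> A u -> A (ev1 f u p).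
  move=> hf hu; elim/poly_ind: p => [|p b IHp]; first by rewrite rmorph0.
  by rewrite rmorphD rmorphM /= ev1C ev1X; apply: addA; [exact: mulA | exact: hf].
by apply: (ev1_in) => // g; apply: (ev1_in) => // p; apply: (ev1_in).
Qed.

Lemma invariants_subalg_closed (k : fieldType) (R : comAlgType k)
    (phi : {rmorphism R -> {poly R}}) :
  exponential_map phi -> GRing.subalg_closed (mem (invariants phi)).
Proof.
move=> hphi; have inP a : (a \in mem (invariants phi)) = (phi a == a%:P).
  by apply/idP/eqP; rewrite inE.
split=> [|s a b|a b]; rewrite !inP; first by rewrite rmorph1.
  move=> /eqP pa /eqP pb; rewrite -mulr_algl rmorphD rmorphM (phi_alg hphi) pa pb.
  by rewrite -polyCM -polyCD.
by move=> /eqP pa /eqP pb; rewrite rmorphM pa pb -polyCM.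
Qed.

Theorem theorem1 (k : fieldType) (c : k) (eta : {poly k}) (heta : eta`_0 = c)
    (phi : {rmorphism coord_ring eta -> {poly (coord_ring eta)}})
    (hphi : Exp phi) :
  let x : coord_ring eta := coord_class eta 'X_0 in
  let z : coord_ring eta := coord_class eta 'X_2 in
  let t : coord_ring eta := coord_class eta 'X_3 in
  invariants phi <> [set: coord_ring eta] ->
  generated_subalg [set x] `<=` invariants phi /\
  invariants phi `<=` generated_subalg [set x; z; t].
Proof.
move=> x z t nontrivial.
have pres : presentation x (coord_class eta 'X_1) z t eta := coord_presentation eta.
have moves : exists a, phi a <> a%:P.
  apply: contrapT => fixed; apply: nontrivial; apply/seteqP; split=> // a _.
  by apply: contrapT => move_a; apply: fixed; exists a.
split.
  apply: smallest_sub; first exact: invariants_subalg_closed.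
  by move=> _ ->; exact: (x_invariant pres hphi moves).
move=> f /(invariants_in_xzt pres hphi moves)[q ->] A [closedA genA].
exact: embed_xzt_generated closedA genA.
Qed.
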